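(* Let $K$ be a field, let $k,\ell,d$ be integers with $2\le k\le \ell\le d$, and let $J_{\Delta}$, $I_0$, $I_S$ and $\mathcal{L}$ be as defined in the context. Then a minimal primary decomposition of the radical of $J_{\Delta}$ is given by $$\sqrt{J_{\Delta}} \;=\; I_0\ \cap\ \bigcap_{S\in\mathcal{L}} I_S .$$
   Context: Let $K$ be a field and $2\le k\le\ell\le d$ integers. Let $P=(p_{x,y})_{x\in[d],\,y\in[k\ell]}$ be a $d\times k\ell$ matrix of indeterminates and $R=K[P]$ the polynomial ring in its entries. For $A\subseteq[d]$, $B\subseteq[k\ell]$ with $|A|=|B|$, $[A|B]$ denotes the determinant of the submatrix of $P$ with rows indexed by $A$ and columns indexed by $B$ (in increasing order). Arrange $[k\ell]$ in a $k\times\ell$ matrix $\mathcal{Y}$ with entries $\mathcal{Y}_{i,j}=(j-1)k+i$ for $i\in[k]$, $j\in[\ell]$. Put $R_i=\{\mathcal{Y}_{i,j}: j\in[\ell]\}$ for $i\in[k]$ (rows of $\mathcal{Y}$) and $C_j=\{\mathcal{Y}_{i,j}: i\in[k]\}$ for $j\in[\ell]$ (columns of $\mathcal{Y}$). Ideals of $R$: - $J_{\Delta}=\langle [A|B] : A\subseteq[d],\ |A|=|B|,\ B\in\Delta\rangle$, where $\Delta=\bigcup_{j\in[\ell]}\{B\subseteq C_j: |B|=2\}\ \cup\ \{R_1,\dots,R_k\}$ (so the generators are the $2$-minors of $P$ with both columns in one $C_j$ and the $\ell$-minors of $P$ with column set some $R_i$). - $I_0=\langle [A|B] : A\subseteq[d],\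 B\subseteq C_j \text{ for some } j\in[\ell],\ |A|=|B|=2\rangle+\langle [A|B]: A\subseteq[d],\ B\subseteq[k\ell],\ |A|=|B|=\ell\rangle$. - For $S\subseteq[k\ell]$: $I_S=\langle p_{i,j}: i\in[d],\ j\in S\rangle+\langle [A|B] : A\subseteq[d],\ B\subseteq C_j \text{ for some } j\in[\ell],\ |A|=|B|=2\rangle$. Finally $\mathcal{L}=\big\{\{\mathcal{Y}_{i_1,j_1},\dots,\mathcal{Y}_{i_k,j_k}\} : |\{i_1,\dots,i_k\}|=k,\ |\{j_1,\dots,j_k\}|\ge 2\big\}$, i.e. the sets containing exactly one element of each $R_i$ and not contained in a single $C_j$. *)

(* Defs.v *)
From mathcomp Require Import all_boot all_algebra mpoly.
From mathcomp Require Import classical_sets.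

Set Implicit Arguments.
Unset Strict Implicit.
Unset Printing Implicit Defensive.

Import GRing.Theory.

Local Open Scope ring_scope.

Section Ideals.
Local Open Scope classical_set_scope.
Variable R : comNzRingType.
Implicit Types I J G : set R.

(* [idealr_closed] of ring_quotient is boolean and excludes the unit ideal,
   hence this Prop-valued version. *)
Definition is_ideal I : Prop :=
  [/\ I 0, forall a b, I a -> I b -> I (a + b) & forall c a, I a -> I (c * a)].

Definition ideal_gen G : set R := smallest is_ideal G.

Definition ideal_add I J : set R := [set a + b | a in I & b in J].

Definition radical I : set R := [set a | exists n : nat, I (a ^+ n)].

Definition primary I : Prop :=
  [/\ is_ideal I, ~ I 1 & forall a b, I (a * b) -> I a \/ radical I b].

Definition minimal_primary_decomposition (T : finType) I (Q : T -> set R)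
    : Prop :=
  [/\ forall t, primary (Q t),
      I = \bigcap_t Q t,
      forall s t, s <> t -> radical (Q s) <> radical (Q t) &
      forall t, ~ (\bigcap_(s in [set s | s <> t]) Q s `<=` Q t)].

End Ideals.

(* [enum_val] lists a set of ordinals in increasing order. *)
Definition minor (R : comNzRingType) (m n : nat) (M : 'M[R]_(m, n))
    (A : {set 'I_m}) (B : {set 'I_n}) (eAB : #|A| = #|B|) : R :=
  \det (\matrix_(i < #|A|, j < #|A|)
          M (enum_val i) (enum_val (cast_ord eAB j))).

Definition minors (R : comNzRingType) (m n : nat) (M : 'M[R]_(m, n))
    (X : {set 'I_m} -> {set 'I_n} -> Prop) : set R :=
  [set p : R | exists (A : {set 'I_m}) (B : {set 'I_n}) (eAB : #|A| = #|B|), X A B /\ p = minor M eAB]%classic.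

Definition generic_mx (K : fieldType) (m n : nat) : 'M[{mpoly K[m * n]}]_(m, n) :=
  \matrix_(x < m, y < n) 'X_(mxvec_index x y).

Section Arrangement.
Variables k l : nat.

Lemma Y_subproof (i : 'I_k) (j : 'I_l) : (j * k + i < k * l)%N.
Proof.
apply: (@leq_trans (j.+1 * k)%N); first by rewrite mulSn addnC ltn_add2r.
by rewrite mulnC leq_mul2l ltn_ord orbT.
Qed.

(* The rows and columns of Y, and its entries, are numbered from 0. *)
Definition Y (i : 'I_k) (j : 'I_l) : 'I_(k * l) := Ordinal (Y_subproof i j).

Definition Yrow (i : 'I_k) : {set 'I_(k * l)} := [set Y i j | j : 'I_l]%SET.

Definition Ycol (j : 'I_l) : {set 'I_(k * l)} := [set Y i j | i : 'I_k]%SET.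

Definition Delta : {set {set 'I_(k * l)}} :=
  ((\bigcup_(j : 'I_l) [set B : {set 'I_(k * l)} | (B \subset Ycol j) && (#|B| == 2%N)])
     :|: [set Yrow i | i : 'I_k])%SET.

Definition calL : {set {set 'I_(k * l)}} :=
  [set [set Y (h t).1 (h t).2 | t : 'I_k]
     | h : {ffun 'I_k -> 'I_k * 'I_l}
     & (#|[set (h t).1 | t : 'I_k]| == k)
       && (2 <= #|[set (h t).2 | t : 'I_k]|)%N]%SET.

End Arrangement.

Section DeterminantalIdeals.
Variables (K : fieldType) (k l d : nat).

Let R := {mpoly K[d * (k * l)]}.
Let P : 'M[R]_(d, k * l) := generic_mx K d (k * l).

Definition J_Delta : set R := ideal_gen (minors P (fun _ B => B \in Delta k l)).

Definition col_2minors : set R :=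
  minors P (fun A B =>
    [/\ exists j : 'I_l, B \subset Ycol k j, #|A| = 2%N & #|B| = 2%N]).

Definition I_0 : set R :=
  ideal_add (ideal_gen col_2minors)
            (ideal_gen (minors P (fun A B => #|A| = l /\ #|B| = l))).

Definition I_ (S : {set 'I_(k * l)}) : set R :=
  ideal_add (ideal_gen [set p : R | exists (i : 'I_d) (j : 'I_(k * l)), j \in S /\ p = P i j]%classic)
            (ideal_gen col_2minors).

(* The components of the decomposition: [None] indexes I_0 and [Some S], for S
   in calL, indexes I_S. *)
Definition component (t : option {S : {set 'I_(k * l)} | S \in calL k l})
    : set R :=
  if t is Some s then I_ (val s) else I_0.

End DeterminantalIdeals.

Arguments J_Delta : clear implicits.
Arguments I_0 : clear implicits.
Arguments I_ K {k l} d S _.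
Arguments component : clear implicits.

(* Main.v *)
Require Import Defs.
From mathcomp Require Import all_boot fingroup perm all_algebra mpoly.
From mathcomp Require Import ssrcomplements.
From mathcomp Require Import boolp classical_sets.
From mathcomp Require Import ring.

(** The theorem is a statement about prime ideals: [I_0] and all [I_ S] turn out
    to be prime, every prime ideal containing [J_Delta] contains one of them,
    and none of them contains another.  Since the radical of an ideal is the
    intersection of the primes above it ([prime_avoiding]), and since finitely
    many pairwise incomparable primes always form a minimal primary
    decomposition of their intersection ([incomparable_primes_minimal]),
    nothing more is needed.

    Primality.  Each component is the kernel of a morphism to a polynomial
    ring, that is, the ideal of a parametrised variety.  When the 2-minors
    inside the blocks [Ycol j] vanish, the blocks have rank at most one, and
    the matrix is [P x y = a x (blk y) * b y], where [blk y] is the block of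
    the column [y].  The kernel of this substitution [segre] is generated by
    the 2-minors: two monomials with the same image are linked by exchanges
    [p_{xy} p_{x'y'} -> p_{xy'} p_{x'y}] ([segre_exchange]).  Killing the [b y]
    for [y] in [S] in addition gives [I_ S] ([I_S_kernel]).  For [I_0] the
    d x l matrix [a] has to have rank less than [l], so it is replaced by a
    generic product of a d x (l-1) and an (l-1) x l matrix.  The kernel of the
    resulting substitution is [I_0] ([I_0_kernel]) for two reasons: a
    polynomial in the entries of [a], and in any other variables, that
    vanishes wherever the columns of [a] are dependent lies in the ideal of
    maximal minors of [a] ([maximal_minors_vanishing]); and the contraction of
    that ideal along [segre] is [I_0], as a multiple of a minor of [a] by a
    monomial is a multiple of the image of a minor of [P] as soon as one of
    its terms is the image of a monomial ([segre_maximal_minors]).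

    Maximal minors.  The theorem on maximal minors holds over any integral
    domain and is proved by killing the entries of the first row one by one,
    from the last to the first.  Let [V_m] be the variety of matrices with
    dependent columns whose first row is zero from column [m] on, and [P_m]
    the ideal generated by the maximal minors and these entries.  The claim is
    that [P_m] contains every polynomial vanishing on [V_m].
    - For [m = 0] it is the theorem for one row less.
    - For [m = 1] the first row is [(x, 0, ..., 0)]; a polynomial vanishing on
      [V_1] is [i + x g] with [i] in [P_1], by the case [m = 0], where [g]
      vanishes as soon as the matrix without its first row and column has
      dependent columns, so that [x g] is in [P_1] by the theorem for that
      smaller matrix.
    - For [m >= 2] let [x] be the entry [m-1] of the first row.  A polynomial
      vanishing on [V_m] is again [i + x g] with [i] in [P_m], by the case
      [m-1].  Every point of [V_m] is a limit of points of [V_m] with [x]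
      nonzero ([vanishing_colon]), so [g] vanishes on [V_m] too, and the
      argument can be repeated: the polynomial lies in [P_m + (x^N)] for all
      [N], hence in [P_m], which is homogeneous ([homogeneous_closed]).
    Points are morphisms to arbitrary integral domains, and limits are
    specialisations at 0 of points over polynomial rings in one variable.

    Primes above [J_Delta].  If a prime [p] contains [J_Delta] but not [I_0],
    some maximal minor [det (P (f s) (g t))] is not in [p], and its columns
    lie in distinct blocks.  For every row [i] of the arrangement, multiplying
    it by entries of the columns of [Yrow i] gives, modulo the 2-minors, a
    multiple of an [l]-minor on the columns [Yrow i].  So [p] contains all
    entries of one column of each [Yrow i].  These columns form an element [S]
    of [calL], and [I_ S] is contained in [p]; they cannot lie in a single
    block, for one of them would then be a column of the minor that is not in
    [p] ([prime_contains_component]). *)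

Set Implicit Arguments.
Unset Strict Implicit.
Unset Printing Implicit Defensive.

Import GRing.Theory.

Local Open Scope ring_scope.

(** * Ideals and primes *)

Section IdealTheory.
Variable R : comNzRingType.
Implicit Types I G : set R.

Lemma ideal_gen_ideal G : is_ideal (ideal_gen G).
Proof.
split=> [|a b Ia Ib|c a Ia] M [idM GM]; case: (idM) => M0 MD MM //.
- by apply: MD; [apply: Ia | apply: Ib].
- by apply: MM; apply: Ia.
Qed.

Lemma ideal_gen_sub G I : is_ideal I -> (G `<=` I -> ideal_gen G `<=` I)%classic.
Proof. exact: smallest_sub. Qed.

Lemma ideal_gen_in G a : G a -> ideal_gen G a.
Proof. exact: sub_gen_smallest. Qed.

Lemma ideal_add_ideal I J : is_ideal I -> is_ideal J -> is_ideal (ideal_add I J).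
Proof.
case=> I0 ID IM [J0 JD JM]; split.
- by exists 0 => //; exists 0 => //; rewrite addr0.
- move=> _ _ [a Ia [b Jb <-]] [a' Ia' [b' Jb' <-]].
  by exists (a + a'); [exact: ID | exists (b + b'); [exact: JD | rewrite addrACA]].
- move=> c _ [a Ia [b Jb <-]].
  by exists (c * a); [exact: IM | exists (c * b); [exact: JM | rewrite mulrDr]].
Qed.

Lemma ideal_add_l I J : is_ideal J -> (I `<=` ideal_add I J)%classic.
Proof. by case=> J0 _ _ a Ia; exists a => //; exists 0 => //; rewrite addr0. Qed.

Lemma ideal_add_r I J : is_ideal I -> (J `<=` ideal_add I J)%classic.
Proof. by case=> I0 _ _ a Ia; exists 0 => //; exists a => //; rewrite add0r. Qed.

Lemma ideal_add_sub I J M :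
  is_ideal M -> (I `<=` M -> J `<=` M -> ideal_add I J `<=` M)%classic.
Proof. by case=> _ MD _ IM JM _ [a Ia [b Jb <-]]; apply: MD; [exact: IM | exact: JM]. Qed.

Section OneIdeal.
Variables (I : set R) (idI : is_ideal I).

Lemma ideal_0 : I 0. Proof. by case: idI. Qed.
Lemma ideal_D a b : I a -> I b -> I (a + b). Proof. by case: idI => _ + _; apply. Qed.
Lemma ideal_Ml c a : I a -> I (c * a). Proof. by case: idI => _ _; apply. Qed.
Lemma ideal_Mr c a : I a -> I (a * c). Proof. by rewrite mulrC; apply: ideal_Ml. Qed.
Lemma ideal_N a : I a -> I (- a). Proof. by rewrite -mulN1r; apply: ideal_Ml. Qed.
Lemma ideal_B a b : I a -> I b -> I (a - b).
Proof. by move=> Ia /ideal_N; apply: ideal_D. Qed.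
Lemma ideal_BC a b : I (a - b) -> I (b - a).
Proof. by move/ideal_N; rewrite opprB. Qed.
Lemma ideal_congr a b : I (a - b) -> I b -> I a.
Proof. by move=> Iab Ib; rewrite -(subrK b a); apply: ideal_D. Qed.

Lemma ideal_sum (T : Type) (s : seq T) (Q : pred T) (F : T -> R) :
  (forall i, Q i -> I (F i)) -> I (\sum_(i <- s | Q i) F i).
Proof. by move=> IF; apply: (big_ind I) => //; [exact: ideal_0 | exact: ideal_D]. Qed.

Lemma ideal_det_col n (M : 'M[R]_n) (j : 'I_n) :
  (forall i, I (M i j)) -> I (\det M).
Proof.
by move=> IM; rewrite (expand_det_col M j); apply: ideal_sum => i _; apply: ideal_Mr.
Qed.

End OneIdeal.

Lemma ideal_ker (S : comNzRingType) (h : {rmorphism R -> S}) :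
  is_ideal [set a | h a = 0]%classic.
Proof.
split=> /= [|a b ha hb|c a ha]; first exact: rmorph0.
- by rewrite rmorphD ha hb addr0.
- by rewrite rmorphM ha mulr0.
Qed.

Definition prime_ideal I : Prop :=
  [/\ is_ideal I, ~ I 1 & forall a b, I (a * b) -> I a \/ I b].

Lemma prime_ker (S : idomainType) (h : {rmorphism R -> S}) :
  prime_ideal [set a | h a = 0]%classic.
Proof.
split=> /=; first exact: ideal_ker.
- by rewrite rmorph1; apply/eqP/oner_neq0.
- by move=> a b /eqP; rewrite rmorphM mulf_eq0 => /orP[] /eqP; [left | right].
Qed.

Lemma prime_exp I a n : prime_ideal I -> I (a ^+ n) -> I a.
Proof.
case=> _ I1 IM; elim: n => [/I1 // | n IHn].
by rewrite exprS => /IM[] // /IHn.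
Qed.

Lemma prime_prod I (T : Type) (s : seq T) (Q : pred T) (F : T -> R) :
  prime_ideal I -> I (\prod_(i <- s | Q i) F i) -> exists2 i, Q i & I (F i).
Proof.
case=> _ I1 IM; elim: s => [|x s IHs]; first by rewrite big_nil => /I1.
rewrite big_cons; case: ifP => [Qx /IM[Ix|/IHs //] | _ /IHs //].
by exists x.
Qed.

Lemma prime_radical I : prime_ideal I -> radical I = I.
Proof.
move=> pI; apply/seteqP; split=> [a [n /prime_exp]|a Ia]; first exact.
by exists 1%N; rewrite expr1.
Qed.

Lemma prime_primary I : prime_ideal I -> primary I.
Proof. by move=> pI; rewrite /primary (prime_radical pI); case: pI. Qed.

(** An ideal that is maximal among those missing the powers of [f] is prime:
    if [a] and [b] are outside it, some powers of [f] are of the form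
    [u + x a] and [v + y b], and their product would put a power of [f] inside
    as soon as [a b] is. *)
Lemma prime_avoiding I f : is_ideal I -> ~ radical I f ->
  exists2 p, prime_ideal p & (I `<=` p)%classic /\ ~ p f.
Proof.
move=> idI nIf.
pose C (X : set R) := [/\ is_ideal X, (I `<=` X)%classic & forall n, ~ X (f ^+ n)].
have CI : C I by split=> // n In; apply: nIf; exists n.
have [F FC totF|A [CA maxA]] :=
    @Zorn_bigcup R [set X | C X \/ X = set0]%classic.
  have [[X FX CX]|nX] := pselect (exists2 X, F X & C X); last first.
    right; apply/seteqP; split=> // x [X FX Xx].
    have [CX|X0] := FC _ FX; first by case: nX; exists X.
    by rewrite X0 in Xx.
  have FC' Z z : F Z -> Z z -> C Z.
    by move=> /FC [] // -> [].
  left; split.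
  - split.
    + by exists X => //; case: CX => [[]].
    + move=> a b [Y FY Ya] [Z FZ Zb].
      have [YZ|ZY] := totF _ _ FY FZ.
        by exists Z => //; apply: ideal_D; [case: (FC' _ _ FZ Zb) | exact: YZ | ].
      by exists Y => //; apply: ideal_D; [case: (FC' _ _ FY Ya) | | exact: ZY ].
    + move=> c a [Y FY Ya]; exists Y => //; apply: ideal_Ml => //.
      by case: (FC' _ _ FY Ya).
  - by move=> x Ix; exists X => //; case: CX => _ + _; apply.
  - by move=> n [Y FY Yn]; case: (FC' _ _ FY Yn) => _ _ /(_ n).
have {}CA : C A.
  case: CA => // A0; case: (maxA I); last by left.
  rewrite A0; split; first by move=> ? [].
  by move=> /(_ 0 (ideal_0 idI)).
have [idA IA nA] := CA.
have big a : ~ A a -> exists n x y, A x /\ f ^+ n = x + y * a.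
  move=> nAa; apply: contrapT => nex.
  pose B := [set z | exists x y, A x /\ z = x + y * a]%classic.
  case: (maxA B).
    split; first by move=> x Ax; exists x, 0; rewrite mul0r addr0.
    move=> /(_ a) BA; apply/nAa/BA.
    by exists 0, 1; rewrite mul1r add0r; split=> //; apply: ideal_0.
  left; split.
  - split.
    + by exists 0, 0; rewrite mul0r addr0; split=> //; apply: ideal_0.
    + move=> _ _ [x [y [Ax ->]]] [x' [y' [Ax' ->]]].
      exists (x + x'), (y + y'); split; first exact: ideal_D.
      by rewrite mulrDl addrACA.
    + move=> c _ [x [y [Ax ->]]]; exists (c * x), (c * y).
      by split; [exact: ideal_Ml | rewrite mulrDr mulrA].
  - by move=> x /IA Ax; exists x, 0; rewrite mul0r addr0.
  - by move=> n [x [y [Ax e]]]; apply: nex; exists n, x, y.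
exists A; last by split=> // Af; apply: (nA 1%N); rewrite expr1.
split=> //; first by move=> A1; apply: (nA 0).
move=> a b Aab; apply: contrapT => /not_orP[/big [n [x [y [Ax en]]]]].
move=> /big [m [x' [y' [Ax' em]]]]; apply: (nA (n + m)%N).
rewrite exprD en em mulrDr; apply: ideal_D => //; first exact: ideal_Ml.
rewrite mulrDl; apply: ideal_D => //; first exact: ideal_Mr.
by rewrite mulrACA; apply: ideal_Ml.
Qed.

(** For prime ideals, minimality of a finite intersection is the absence of
    inclusions: a product of elements of the other primes that avoid [Q t]
    lies in all of them but not in [Q t]. *)
Lemma incomparable_primes_minimal (T : finType) I (Q : T -> set R) :
  (forall t, prime_ideal (Q t)) -> I = (\bigcap_t Q t)%classic ->
  (forall s t, s != t -> ~ (Q s `<=` Q t)%classic) ->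
  minimal_primary_decomposition I Q.
Proof.
move=> pQ eI nQ; split=> // [t | s t /eqP nst | t sub].
- exact: prime_primary.
- by rewrite !prime_radical // => e; apply: (nQ _ _ nst); rewrite e.
have wit s : exists a, s != t -> Q s a /\ ~ Q t a.
  have [->|/(nQ _ _)] := eqVneq s t; first by exists 0.
  move=> /existsNP [a /not_implyP [Qa nQa]]; by exists a.
have [e eP] := choice wit.
have /(prime_prod (pQ t)) : Q t (\prod_(s | s != t) e s).
  apply: sub => s /= /eqP nst; rewrite (bigD1 s) //=.
  by apply: ideal_Mr; [case: (pQ s) | case: (eP s nst)].
by case=> s /eP[].
Qed.

End IdealTheory.

(** * Morphisms from polynomial rings *)

Section PolynomialRings.
Variables (K : comNzRingType) (n : nat).
Local Notation R := {mpoly K[n]}.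

Lemma mpoly_ring_ind (Q : R -> Prop) :
  (forall c, Q c%:MP) -> (forall i, Q 'X_i) ->
  (forall p q, Q p -> Q q -> Q (p + q)) -> (forall p q, Q p -> Q q -> Q (p * q)) ->
  forall p, Q p.
Proof.
move=> QC QX QD QM p; rewrite (mpolyE p).
apply: (big_ind Q) => // [|m _]; first by rewrite -mpolyC0; exact: QC.
rewrite -mul_mpolyC; apply: (QM) => //; rewrite mpolyXE_id.
apply: (big_ind Q) => [|a b|i _]; [by rewrite -mpolyC1; exact: QC | exact: QM |].
elim: (m i) => [|k IHk]; first by rewrite expr0 -mpolyC1; exact: QC.
by rewrite exprS; apply: QM.
Qed.

Lemma mpoly_morph_ext (S : comNzRingType) (f g : {rmorphism R -> S}) :
  (forall c, f c%:MP = g c%:MP) -> (forall i, f 'X_i = g 'X_i) -> f =1 g.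
Proof.
move=> eC eX; apply: mpoly_ring_ind => // p q ep eq.
- by rewrite !rmorphD ep eq.
- by rewrite !rmorphM ep eq.
Qed.

(** Sealed, so that unification never unfolds an evaluation into sums. *)
Fact mpoly_subst_key (S : comNzRingType) (c : {rmorphism K -> S}) (v : 'I_n -> S) :
  {h : {rmorphism R -> S} | (forall a, h a%:MP = c a) /\ forall i, h 'X_i = v i}.
Proof.
exists [the {rmorphism R -> S} of mmap c v].
by split=> [a|i]; rewrite /= ?mmapC // mmapX mmap1U.
Qed.

Definition mpoly_subst (S : comNzRingType) (c : {rmorphism K -> S}) (v : 'I_n -> S)
  : {rmorphism R -> S} := sval (mpoly_subst_key c v).

Lemma substC (S : comNzRingType) (c : {rmorphism K -> S}) v a :
  mpoly_subst c v a%:MP = c a.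
Proof. by case: (svalP (mpoly_subst_key c v)). Qed.

Lemma substX (S : comNzRingType) (c : {rmorphism K -> S}) v i :
  mpoly_subst c v 'X_i = v i.
Proof. by case: (svalP (mpoly_subst_key c v)). Qed.

Definition endo (v : 'I_n -> R) : {rmorphism R -> R} :=
  mpoly_subst [the {rmorphism K -> R} of @mpolyC n K] v.

(** A polynomial only changes by elements of [I] when its variables do. *)
Lemma endo_congr (I : set R) (v : 'I_n -> R) (p : R) : is_ideal I ->
  (forall i, I ('X_i - v i)) -> I (p - endo v p).
Proof.
move=> idI Iv; elim/mpoly_ring_ind: p => [c|i|p q Ip Iq|p q Ip Iq].
- by rewrite substC subrr; apply: ideal_0.
- by rewrite substX.
- by rewrite rmorphD opprD addrACA; apply: ideal_D.
- rewrite rmorphM.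
  have -> : p * q - endo v p * endo v q =
    (p - endo v p) * q + endo v p * (q - endo v q).
    by rewrite mulrBl mulrBr addrA subrK.
  by apply: ideal_D => //; [apply: ideal_Mr | apply: ideal_Ml].
Qed.

End PolynomialRings.

(** * Maximal minors of a generic matrix *)

Definition dependent (D : comNzRingType) (d l : nat) (M : 'I_d -> 'I_l -> D) :=
  exists c : 'I_l -> D, (exists j, c j != 0) /\ forall x, \sum_j M x j * c j = 0.

Definition maximal_minors (D : comNzRingType) (d l : nat) (M : 'I_d -> 'I_l -> D)
    : set D :=
  [set p | exists A : 'I_l -> 'I_d, p = \det (\matrix_(s, t) M (A s) t)]%classic.

Lemma dependent_det (D : idomainType) d l (M : 'I_d -> 'I_l -> D) A :
  dependent M -> \det (\matrix_(s, t) M (A s) t) = 0.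
Proof.
case=> c [[j cj] Mc]; set N := \matrix_(_, _) _.
pose v := \col_j c j.
have Nv : N *m v = 0.
  apply/colP => s; rewrite !mxE -[RHS](Mc (A s)).
  by apply: eq_bigr => i _; rewrite !mxE.
have : \adj N *m (N *m v) = 0 by rewrite Nv mulmx0.
rewrite mulmxA mul_adj_mx mul_scalar_mx => /colP /(_ j) /eqP.
by rewrite !mxE mulf_eq0 (negPf cj) orbF => /eqP.
Qed.

Section Deformation.
Variables (K : comNzRingType) (n : nat).
Local Notation T := {mpoly K[n]}.

Section Homogeneous.

Local Notation polyT := {poly T}.

Definition dilate : {rmorphism T -> polyT} :=
  mpoly_subst [the {rmorphism K -> polyT} of polyC \o @mpolyC n K]
        (fun i => ('X_i)%:P * 'X).

Lemma dilate1 p : (dilate p).[1] = p.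
Proof.
pose h := [the {rmorphism T -> T} of horner_eval (1 : T) \o dilate].
have /(_ p) // : h =1 idfun.
apply: mpoly_morph_ext => [c|i]; rewrite /h /= /horner_eval.
  by rewrite substC /= hornerC.
by rewrite substX hornerM hornerC hornerX mulr1.
Qed.

(** A homogeneous ideal is closed for the adic topology of a variable: below
    degree [N] the homogeneous components of [f] are those of an element of
    the ideal.  The components of [p] are the coefficients of [dilate p], the
    image of [p] under ['X_i |-> 'X_i * 'X]. *)
Lemma homogeneous_closed (G : set T) (i : 'I_n) (f : T) :
  (forall p, G p -> exists e, dilate p = p%:P * 'X^e) ->
  (forall N, exists a g, ideal_gen G a /\ f = a + 'X_i ^+ N * g) ->
  ideal_gen G f.
Proof.
move=> hG hf; have idG := ideal_gen_ideal G.
have coefI a e : ideal_gen G a -> ideal_gen G (dilate a)`_e.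
  pose C := [set b | forall e, ideal_gen G (dilate b)`_e]%classic.
  move=> Ga; suff /(_ a Ga) : (ideal_gen G `<=` C)%classic by apply.
  apply: ideal_gen_sub => [|b Gb e'].
    split=> [e'|b b' Cb Cb' e'|c b Cb e'].
    - by rewrite rmorph0 coef0; apply: (ideal_0 idG).
    - by rewrite rmorphD coefD; exact: (ideal_D idG (Cb e') (Cb' e')).
    - by rewrite rmorphM coefM; apply: (ideal_sum idG) => j _; apply: (ideal_Ml idG).
  have [e0 ->] := hG _ Gb; rewrite coefCM; exact: (ideal_Mr idG _ (ideal_gen_in Gb)).
rewrite -(dilate1 f) horner_coef; apply: (ideal_sum idG) => // -[e /= lt_e] _.
rewrite expr1n mulr1.
have [a [g [Ga ef]]] := hf (size (dilate f)).
suff -> : (dilate f)`_e = (dilate a)`_e by exact: coefI.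
rewrite {1}ef rmorphD rmorphM rmorphXn /= substX.
by rewrite exprMn coefD mulrAC coefMXn lt_e addr0.
Qed.

End Homogeneous.

(** The point [th] is the limit at 0 of the curve with coordinates [B]; the
    coordinates outside the matrix are kept constant along the curve. *)
Lemma deform (d l : nat) (iota : 'I_d -> 'I_l -> 'I_n) (D : comNzRingType)
    (th : {rmorphism T -> D}) (B : 'I_d -> 'I_l -> {poly D}) :
  (forall x j x' j', iota x j = iota x' j' -> x = x' /\ j = j') ->
  (forall x j, (B x j).[0] = th 'X_(iota x j)) ->
  exists2 tht : {rmorphism T -> {poly D}},
    forall x j, tht 'X_(iota x j) = B x j & forall p, (tht p).[0] = th p.
Proof.
move=> inj B0.
pose v i := if [pick u | iota u.1 u.2 == i] is Some u then B u.1 u.2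
            else (th 'X_i)%:P.
pose tht := mpoly_subst [the {rmorphism K -> {poly D}} of polyC \o (th \o @mpolyC n K)] v.
exists tht => [x j|p].
  rewrite substX /v; case: pickP => [u /eqP/inj[-> ->] //|/(_ (x, j))].
  by rewrite eqxx.
pose h := [the {rmorphism T -> D} of horner_eval (0 : D) \o tht].
suff /(_ p) : h =1 th by [].
apply: mpoly_morph_ext => [c|i]; rewrite /h /= /horner_eval.
  by rewrite substC /= hornerC.
rewrite substX /v; case: pickP => [u /eqP <-|_]; first exact: B0.
by rewrite hornerC.
Qed.

Definition kill (J : pred 'I_n) : {rmorphism T -> T} :=
  endo (fun i => if J i then 0 else 'X_i).

Lemma killX (J : pred 'I_n) i : kill J 'X_i = if J i then 0 else 'X_i.
Proof. exact: substX. Qed.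

Lemma kill_congr (I : set T) (J : pred 'I_n) p : is_ideal I -> (forall i, J i -> I 'X_i) ->
  I (p - kill J p).
Proof.
move=> idI IJ; apply: endo_congr => // i.
by case: ifP => [/IJ|_]; rewrite ?subr0 // subrr => *; apply: ideal_0.
Qed.

End Deformation.

(** If [th] is the limit of a curve along which [x * g] vanishes, but [x] does
    not vanish identically, then [g] vanishes at [th]. *)
Lemma deform_colon (K : idomainType) (n d l : nat) (iota : 'I_d -> 'I_l -> 'I_n)
    (D : idomainType) (th : {rmorphism {mpoly K[n]} -> D})
    (B : 'I_d -> 'I_l -> {poly D}) x j g :
  (forall x j x' j', iota x j = iota x' j' -> x = x' /\ j = j') ->
  (forall x j, (B x j).[0] = th 'X_(iota x j)) -> B x j != 0 ->
  (forall tht : {rmorphism {mpoly K[n]} -> {poly D}},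
      (forall x j, tht 'X_(iota x j) = B x j) -> tht ('X_(iota x j) * g) = 0) ->
  th g = 0.
Proof.
move=> inj B0 Bn0 van; have [tht thtX <-] := deform inj B0.
move: (van _ thtX) => /eqP; rewrite rmorphM mulf_eq0 thtX (negPf Bn0) /=.
by move=> /eqP ->; rewrite horner0.
Qed.

Section Staircase.
Variables (K : idomainType) (n d l : nat).
Variable iota : 'I_d.+1 -> 'I_l.+1 -> 'I_n.
Hypothesis inj : forall x j x' j', iota x j = iota x' j' -> x = x' /\ j = j'.
Local Notation T := {mpoly K[n]}.

(** The points of the variety [V_m] over the domain [D]: the columns are
    dependent and the first row is zero from column [m] on. *)
Definition points m (D : idomainType) (th : {rmorphism T -> D}) :=
  dependent (fun x j => th 'X_(iota x j)) /\
  forall j : 'I_l.+1, (m <= j)%N -> th 'X_(iota ord0 j) = 0.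

Definition vanishing m : set T := [set f |
  forall (D : idomainType) (th : {rmorphism T -> D}), points m th -> th f = 0]%classic.

Definition staircase_gens m : set T :=
  [set p | maximal_minors (fun x j => 'X_(iota x j) : T) p \/
           exists2 j : 'I_l.+1, (m <= j)%N & p = 'X_(iota ord0 j)]%classic.

Definition staircase m := ideal_gen (staircase_gens m).

Lemma vanishing_ideal m : is_ideal (vanishing m).
Proof.
split=> [D th _|a b va vb D th pt|c a va D th pt]; first exact: rmorph0.
- by rewrite rmorphD va // vb // addr0.
- by rewrite rmorphM va // mulr0.
Qed.

Lemma staircase_vanishing m : (staircase m `<=` vanishing m)%classic.
Proof.
apply: ideal_gen_sub => [|p]; first exact: vanishing_ideal.
case=> [[A ->]|[j mj ->]] D th [dep th0]; last exact: th0.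
rewrite -det_map_mx -[RHS](dependent_det A dep); congr (\det _).
by apply/matrixP => s t; rewrite !mxE.
Qed.

Lemma vanishing_mono m f : vanishing m.+1 f -> vanishing m f.
Proof.
by move=> vf D th [dep th0]; apply: vf; split=> // j /ltnW; apply: th0.
Qed.

Lemma staircase_succ (p : 'I_l.+1) f : staircase p f ->
  exists a g, staircase p.+1 a /\ f = a + 'X_(iota ord0 p) * g.
Proof.
have idS := ideal_gen_ideal (staircase_gens p.+1).
move=> Sf; pose C := [set f | exists a g, staircase p.+1 a /\
                       f = a + 'X_(iota ord0 p) * g]%classic.
suff /(_ f Sf) : (staircase p `<=` C)%classic by apply.
  apply: (@ideal_gen_sub T (staircase_gens p) C) => [|q].
  split.
  - by exists 0, 0; rewrite mulr0 addr0; split=> //; exact: (ideal_0 idS).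
  - move=> _ _ [a [g [Sa ->]]] [a' [g' [Sa' ->]]].
    exists (a + a'), (g + g'); split; first exact: (ideal_D idS).
    by rewrite mulrDr addrACA.
  - move=> c _ [a [g [Sa ->]]]; exists (c * a), (c * g).
    by split; [exact: (ideal_Ml idS) | rewrite mulrDr mulrCA].
case=> [minq|[j pj ->]].
  by exists q, 0; rewrite mulr0 addr0; split=> //; apply: ideal_gen_in; left.
have [->|ne] := eqVneq j p.
  by exists 0, 1; rewrite mulr1 add0r; split=> //; exact: (ideal_0 idS).
exists 'X_(iota ord0 j), 0; rewrite mulr0 addr0; split=> //.
apply: ideal_gen_in; right; exists j => //.
by rewrite ltn_neqAle pj andbT; apply: contraNneq ne => /val_inj ->.
Qed.

(** For [p > 0], every point [a] of [V_(p+1)], with [c] a relation between its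
    columns, is a limit of points of the same variety where entry [p] of the
    first row is nonzero.  If [c 0 <> 0], adding a multiple of
    [c 0 * e_p - c p * e_0] to the first row keeps the relation [c].  If
    [c 0 = 0], the relation itself is moved to [c - t (c p) e_0]: the other
    rows are corrected in a column [j0] with [c j0 <> 0], and the first row
    [r] becomes [r + t e_0 + t (r 0 + t) e_p].  Taking for [t] a multiple of
    [c j0] makes the correction possible without division. *)
Lemma vanishing_colon (p : 'I_l.+1) g : p != ord0 ->
  vanishing p.+1 ('X_(iota ord0 p) * g) -> vanishing p.+1 g.
Proof.
move=> p0 vxg D th [[c [[j0 cj0] dep]] th0].
have [co|co] := eqVneq (c ord0) 0.
  have j00 : j0 != ord0 by apply: contraNneq cj0 => ->; rewrite co.
  pose t : {poly D} := 'X * (c j0)%:P.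
  pose r0 := (th 'X_(iota ord0 ord0))%:P.
  pose B x j : {poly D} := (th 'X_(iota x j))%:P +
    if x == ord0 then
      (if j == ord0 then t else if j == p then t * (r0 + t) else 0)
    else if j == j0 then 'X * (th 'X_(iota x ord0) * c p)%:P else 0.
  have t0 : t.[0] = 0 by rewrite hornerM hornerX mul0r.
  have B0 x j : (B x j).[0] = th 'X_(iota x j).
    rewrite hornerD hornerC; do ![case: ifP => _];
    by rewrite ?hornerM ?hornerX ?t0 ?horner0 ?mul0r ?addr0.
  apply: (deform_colon (x := ord0) (j := p) inj B0) => [|tht thtX].
    rewrite /B eqxx (negPf p0) eqxx /t /r0.
    set a := th _; set b := th _; set e := c j0.
    have -> : a%:P + 'X * e%:P * (b%:P + 'X * e%:P) =
      a%:P + 'X * (e * b)%:P + 'X^2 * (e * e)%:P by rewrite !polyCM; ring.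
    apply/eqP => /(congr1 (fun q : {poly D} => q`_2)).
    rewrite 2!coefD coefC coefXM coefC coefXnM coefC /= !add0r.
    by rewrite coef0; apply/eqP; rewrite mulf_neq0.
  apply: vxg; split; last first.
    move=> j pj; rewrite thtX /B eqxx th0 //.
    have pj' : j != p by apply: contraTneq pj => ->; rewrite ltnn.
    have oj' : j != ord0 by apply: contraTneq pj => ->.
    by rewrite (negPf pj') (negPf oj') addr0.
  exists (fun j => (c j)%:P - (if j == ord0 then t * (c p)%:P else 0)).
  split.
    by exists j0; rewrite (negPf j00) subr0 polyC_eq0.
  move=> x; have := congr1 (fun q => q%:P) (dep x); rewrite rmorph_sum /= => depx.
  have [x0|xn0] := eqVneq x ord0.
    move: depx; rewrite (bigD1 ord0) // (bigD1 p) //= x0.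
    rewrite [X in _ = X -> _](_ : _ = 0) // => depx.
    rewrite (bigD1 ord0) // (bigD1 p) //= !thtX /B !eqxx (negPf p0).
    rewrite -[RHS]depx !rmorphM co.
    rewrite (eq_bigr (fun i => (th 'X_(iota ord0 i) * c i)%:P)); last first.
      by move=> i /andP[/negPf i0 /negPf ip]; rewrite thtX /B eqxx i0 ip
        addr0 subr0 rmorphM.
    rewrite -/r0 !rmorph0; ring.
  move: depx; rewrite (bigD1 ord0) // (bigD1 j0) //=.
  rewrite [X in _ = X -> _](_ : _ = 0) // => depx.
  rewrite (bigD1 ord0) // (bigD1 j0) //= !thtX /B (negPf xn0) !eqxx.
  rewrite (negPf j00) eq_sym (negPf j00).
  rewrite -[RHS]depx !rmorphM co.
  rewrite (eq_bigr (fun i => (th 'X_(iota x i) * c i)%:P)); last first.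
    by move=> i /andP[/negPf i0 /negPf ip]; rewrite thtX /B (negPf xn0) i0 ip
      addr0 subr0 rmorphM.
  rewrite /t !rmorph0; ring.
pose B x j : {poly D} := (th 'X_(iota x j))%:P +
  if x == ord0 then
    (if j == ord0 then - ('X * (c p)%:P) else
     if j == p then 'X * (c ord0)%:P else 0)
  else 0.
have B0 x j : (B x j).[0] = th 'X_(iota x j).
  rewrite hornerD hornerC; do ![case: ifP => _];
  by rewrite ?hornerN ?hornerM ?hornerX ?horner0 ?mul0r ?oppr0 ?addr0.
apply: (deform_colon (x := ord0) (j := p) inj B0) => [|tht thtX].
  rewrite /B eqxx (negPf p0) eqxx.
  apply/eqP => /(congr1 (fun q : {poly D} => q`_1)).
  by rewrite coefD !coefC coefXM coefC /= add0r ?coef0; apply/eqP.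
apply: vxg; split; last first.
  move=> j pj; rewrite thtX /B eqxx th0 //.
  have pj' : j != p by apply: contraTneq pj => ->; rewrite ltnn.
  have oj' : j != ord0 by apply: contraTneq pj => ->.
  by rewrite (negPf pj') (negPf oj') addr0.
exists (fun j => (c j)%:P); split; first by exists j0; rewrite polyC_eq0.
move=> x; have := congr1 (fun q => q%:P) (dep x); rewrite rmorph_sum /= => depx.
have [x0|xn0] := eqVneq x ord0; last first.
  rewrite -[RHS]depx; apply: eq_bigr => j _.
  by rewrite thtX /B (negPf xn0) addr0 rmorphM.
move: depx; rewrite (bigD1 ord0) // (bigD1 p) //= x0.
rewrite [X in _ = X -> _](_ : _ = 0) // => depx.
rewrite (bigD1 ord0) // (bigD1 p) //= !thtX /B !eqxx (negPf p0).
rewrite -[RHS]depx !rmorphM.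
rewrite (eq_bigr (fun i => (th 'X_(iota ord0 i) * c i)%:P)); last first.
  by move=> i /andP[/negPf i0 /negPf ip]; rewrite thtX /B eqxx i0 ip
    addr0 rmorphM.
ring.
Qed.

End Staircase.

Section StaircaseInduction.
Variables (K : idomainType) (n d l : nat).
Variable iota : 'I_d.+1 -> 'I_l.+1 -> 'I_n.
Hypothesis inj : forall x j x' j', iota x j = iota x' j' -> x = x' /\ j = j'.
Local Notation T := {mpoly K[n]}.

Lemma dilate_gens m p : staircase_gens iota m p ->
  exists e, dilate K n p = p%:P * 'X^e :> {poly T}.
Proof.
case=> [[A ->]|[j _ ->]]; last by exists 1%N; rewrite substX expr1.
exists l.+1; rewrite -det_map_mx.
set M := \matrix_(s, t) _.
have -> : map_mx (dilate K n) M = 'X *: map_mx polyC M.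
  by apply/matrixP => s t; rewrite !mxE substX mulrC.
by rewrite detZ det_map_mx mulrC.
Qed.

Lemma staircase_full (f : T) : staircase iota l.+1 f ->
  ideal_gen (maximal_minors (fun x j => 'X_(iota x j) : T)) f.
Proof.
set C := ideal_gen _ => Sf; suff /(_ f Sf) : (staircase (K := K) iota l.+1 `<=` C)%classic by apply.
apply: ideal_gen_sub => [|p]; first exact: ideal_gen_ideal.
by case=> [minp|[j]]; [exact: ideal_gen_in | rewrite leqNgt ltn_ord].
Qed.

(** Here [x] stands for entry [p] of the first row: polynomials vanishing on
    [V_(p+1)] are in [P_(p+1) + x (polynomials vanishing on V_(p+1))], and
    iterating this brings in arbitrarily high powers of [x]. *)
Lemma staircase_step (p : 'I_l.+1) : p != ord0 ->
  (forall f : T, vanishing iota p f -> staircase iota p f) ->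
  forall f : T, vanishing iota p.+1 f -> staircase iota p.+1 f.
Proof.
move=> p0 IH f vf.
suff hf N : exists a g, [/\ staircase iota p.+1 a, vanishing iota p.+1 g
                         & f = a + 'X_(iota ord0 p) ^+ N * g].
  apply: (@homogeneous_closed _ _ _ (iota ord0 p)) => [q|N]; first exact: dilate_gens.
  by have [a [g [Sa _ ef]]] := hf N; exists a, g.
have idS := ideal_gen_ideal (@staircase_gens K _ _ _ iota p.+1).
elim: N => [|N [a [g [Sa vg ->]]]].
  by exists 0, f; split=> //; [exact: (ideal_0 idS) | rewrite add0r mul1r].
have [b [h [Sb eg]]] := staircase_succ (IH _ (vanishing_mono vg)).
exists (a + 'X_(iota ord0 p) ^+ N * b), h; split.
- by apply: (ideal_D idS Sa); apply: (ideal_Ml idS).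
- apply: (vanishing_colon inj p0).
  have -> : 'X_(iota ord0 p) * h = g - b by rewrite eg addrC addKr.
  have vb := staircase_vanishing Sb.
  exact: (ideal_B (vanishing_ideal K iota p.+1) vg vb).
- by rewrite eg mulrDr addrA exprSr mulrA.
Qed.

Hypothesis IHd : forall (l' : nat) (jota : 'I_d -> 'I_l' -> 'I_n),
  (forall x j x' j', jota x j = jota x' j' -> x = x' /\ j = j') ->
  forall f : T,
  (forall (D : idomainType) (th : {rmorphism T -> D}),
      dependent (fun x j => th 'X_(jota x j)) -> th f = 0) ->
  ideal_gen (maximal_minors (fun x j => 'X_(jota x j) : T)) f.

(** With a zero first row, dependence of the columns is a condition on the
    other rows only. *)
Lemma staircase0 (f : T) : vanishing iota 0 f -> staircase iota 0 f.
Proof.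
move=> vf; have idS := ideal_gen_ideal (@staircase_gens K _ _ _ iota 0).
pose J := [pred i | [exists j, i == iota ord0 j]].
pose jota x j := iota (lift ord0 x) j.
have Jj x j : J (jota x j) = false.
  by apply/existsP => -[j' /eqP/inj[/eqP]]; rewrite eq_sym (negPf (neq_lift _ _)).
apply: (ideal_congr idS (b := kill K J f)).
  apply: kill_congr => // i /existsP[j /eqP ->].
  by apply: ideal_gen_in; right; exists j.
have : ideal_gen (maximal_minors (fun x j => 'X_(jota x j) : T)) (kill K J f).
  apply: IHd => [x j x' j' /inj[/lift_inj]//|D th [c [cn0 dep]]].
  apply: (vf D [the {rmorphism T -> D} of th \o kill K J]); split=> /=; last first.
    move=> j _; rewrite killX ifT ?rmorph0 //.
    by apply/existsP; exists j.
  exists c; split=> // x; case: (unliftP ord0 x) => [x' ->|->].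
    rewrite -[RHS](dep x'); apply: eq_bigr => j _.
    by rewrite killX -/(jota x' j) Jj.
  rewrite big1 // => j _; rewrite killX ifT ?rmorph0 ?mul0r //.
  by apply/existsP; exists j.
move: (kill K J f).
apply: ideal_gen_sub => [|_ [A ->]]; first exact: idS.
by apply: ideal_gen_in; left; exists (fun s => lift ord0 (A s)).
Qed.

(** When the first row is [(x, 0, ..., 0)] with [x] moving freely, a relation
    between the columns of the matrix without its first row and column
    extends by 0 to a relation between all columns; and [x] times a maximal
    minor of that smaller matrix is, modulo the killed entries, a maximal
    minor of the whole matrix. *)
Lemma staircase1 (f : T) : vanishing iota 1 f -> staircase iota 1 f.
Proof.
move=> vf; have idS := ideal_gen_ideal (@staircase_gens K _ _ _ iota 1).
have [a [g [Sa ef]]] := staircase_succ (p := ord0) (staircase0 (vanishing_mono vf)).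
rewrite ef; apply: (ideal_D idS) => //.
have {ef} vxg : vanishing iota 1 ('X_(iota ord0 ord0) * g).
  have -> : 'X_(iota ord0 ord0) * g = f - a by rewrite ef addrC addKr.
  by apply: (ideal_B (vanishing_ideal K iota 1) vf); apply: staircase_vanishing.
pose J := [pred i | [exists j : 'I_l, i == iota ord0 (lift ord0 j)]].
have J0 j : J (iota ord0 (lift ord0 j)) by apply/existsP; exists j.
have J00 : J (iota ord0 ord0) = false.
  by apply/existsP => -[j' /eqP/inj[_ /eqP]]; rewrite (negPf (neq_lift _ _)).
have Jlift x j : J (iota (lift ord0 x) j) = false.
  by apply/existsP => -[j' /eqP/inj[/eqP]]; rewrite eq_sym (negPf (neq_lift _ _)).
pose jota x j := iota (lift ord0 x) (lift ord0 j).
have SJ i : J i -> staircase iota 1 'X_i.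
  by move=> /existsP[j /eqP ->]; apply: ideal_gen_in; right; exists (lift ord0 j).
apply: (ideal_congr idS (b := 'X_(iota ord0 ord0) * kill K J g)).
  by rewrite -mulrBr; apply: (ideal_Ml idS); apply: kill_congr => // i; apply: SJ.
have : ideal_gen (maximal_minors (fun x j => 'X_(jota x j) : T)) (kill K J g).
  apply: IHd => [x j x' j' /inj[/lift_inj -> /lift_inj ->]//|D th [c [[j0 cj0] dep]]].
  (* the point where the rest of the first row is zero, and the curve through
     it along which only the first entry moves *)
  pose th' := [the {rmorphism T -> D} of th \o kill K J].
  pose B x j : {poly D} := (th' 'X_(iota x j))%:P +
    (if (x == ord0) && (j == ord0) then 'X else 0).
  have B0 x j : (B x j).[0] = th' 'X_(iota x j).
    by rewrite hornerD hornerC; case: ifP; rewrite ?hornerX ?horner0 addr0.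
  rewrite -[LHS]/(th' g).
  apply: (deform_colon (x := ord0) (j := ord0) inj B0) => [|tht thtX].
    apply/eqP => /(congr1 (fun q : {poly D} => q`_1)).
    by rewrite /B !eqxx coefD coefX coefC coef0 add0r; apply/eqP/oner_neq0.
  apply: vxg; split; last first.
    move=> j; case: (unliftP ord0 j) => [j' ->|->] // _.
    by rewrite thtX /B /= killX J0 rmorph0 addr0.
  exists (fun j => if unlift ord0 j is Some j' then (c j')%:P else 0); split.
    by exists (lift ord0 j0); rewrite liftK polyC_eq0.
  move=> x; rewrite big_ord_recl unlift_none mulr0 add0r.
  case: (unliftP ord0 x) => [x' ->|->].
    rewrite -[RHS](rmorph0 (@polyC D)) -(dep x') rmorph_sum.
    apply: eq_bigr => j _; rewrite liftK thtX /B /= addr0 killX Jlift.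
    by rewrite rmorphM.
  rewrite big1 // => j _.
  by rewrite thtX /B /= killX J0 rmorph0 addr0 mul0r.
pose C : set T := [set b | staircase iota 1 ('X_(iota ord0 ord0) * b)]%classic.
suff sub : (ideal_gen (maximal_minors (fun x j => 'X_(jota x j) : T)) `<=` C)%classic.
  exact: sub.
apply: ideal_gen_sub => [|_ [A ->]].
  split=> [|b b' Cb Cb'|e b Cb].
  - by rewrite /C /= mulr0; exact: (ideal_0 idS).
  - by rewrite /C /= mulrDr; exact: (ideal_D idS).
  - by rewrite /C /= mulrCA; exact: (ideal_Ml idS).
rewrite /C /=.
pose A' s := if unlift ord0 s is Some s' then lift ord0 (A s') else ord0.
have : staircase iota 1 (\det (\matrix_(s, t) ('X_(iota (A' s) t) : T))).
  by apply: ideal_gen_in; left; exists A'.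
rewrite (expand_det_row _ ord0) big_ord_recl.
set S := \sum_(_ < _) _; have IS : staircase iota 1 S.
  apply: (ideal_sum idS) => j _; apply: (ideal_Mr idS).
  by rewrite mxE /A' unlift_none; apply: SJ.
move=> /(fun h => ideal_B idS h IS); rewrite addrK mxE /A' unlift_none.
rewrite /cofactor addn0 expr0 mul1r.
congr (staircase iota 1 (_ * \det _)); apply/matrixP => s t.
by rewrite !mxE liftK.
Qed.

End StaircaseInduction.

(** The ideal of maximal minors of a generic matrix is the ideal of all
    polynomials that vanish where the columns are dependent.  The polynomial
    ring may have variables outside the matrix; this is what allows the
    induction to discard rows and columns without changing the ring.  For
    [l = 0] there is no point and the ideal contains the empty minor 1; with
    no rows and [l > 0] the generic point is one of the points. *)
Theorem maximal_minors_vanishing (K : idomainType) (n d l : nat)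
    (iota : 'I_d -> 'I_l -> 'I_n) :
  (forall x j x' j', iota x j = iota x' j' -> x = x' /\ j = j') ->
  forall f : {mpoly K[n]},
  (forall (D : idomainType) (th : {rmorphism {mpoly K[n]} -> D}),
      dependent (fun x j => th 'X_(iota x j)) -> th f = 0) ->
  ideal_gen (maximal_minors (fun x j => 'X_(iota x j) : {mpoly K[n]})) f.
Proof.
elim: d l iota => [|d IHd] l iota inj f van.
  case: l iota inj van => [|l] iota inj van.
    rewrite -[f]mulr1; apply: (ideal_Ml (ideal_gen_ideal _)); apply: ideal_gen_in.
    by exists id; rewrite det_mx00.
  have -> : f = 0.
    apply: (van _ [the {rmorphism {mpoly K[n]} -> {mpoly K[n]}} of idfun]).
    exists (fun=> 1); split; last by case.
    by exists ord0; exact: oner_neq0.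
  exact: (ideal_0 (ideal_gen_ideal _)).
case: l iota inj van => [|l] iota inj van.
  rewrite -[f]mulr1; apply: (ideal_Ml (ideal_gen_ideal _)); apply: ideal_gen_in.
  by exists (fun=> ord0); rewrite det_mx00.
apply: staircase_full.
suff chain m : (m <= l)%N -> forall g : {mpoly K[n]},
    vanishing iota m.+1 g -> staircase iota m.+1 g.
  by apply: (chain l) => // D th [dep _]; apply: van.
elim: m => [_|m IHm lt_ml]; first exact: (staircase1 inj).
exact: (@staircase_step _ _ _ _ _ inj (Ordinal (lt_ml : m.+1 < l.+1)%N) isT (IHm (ltnW lt_ml))).
Qed.

(** * Matrices with blocks of proportional columns *)

Lemma mpoly_linear_extension (K : comNzRingType) (n : nat) (V : lmodType K)
    (s : 'X_{1..n} -> V) :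
  exists sigma : {mpoly K[n]} -> V,
    (forall p q, sigma (p + q) = sigma p + sigma q) /\
    forall c m, sigma (c *: 'X_[m]) = c *: s m.
Proof.
pose sigma (p : {mpoly K[n]}) := \sum_(m <- msupp p) p@_m *: s m.
have sigmaE p i : (msize p <= i)%N ->
    sigma p = \sum_(m : 'X_{1..n < i}) p@_m *: s m.
  move=> le_pi; set I : subFinType _ := 'X_{1..n < i}.
  rewrite /sigma (big_mksub I) ?msupp_uniq //=; first last.
    by move=> x /msize_mdeg_lt /leq_trans; apply.
  by rewrite big_rmcond //= => j /memN_msupp_eq0 ->; rewrite scale0r.
exists sigma; split=> [p q|c m].
  set i := maxn (msize (p + q)) (maxn (msize p) (msize q)).
  have ip : (msize p <= i)%N by rewrite /i !leq_max leqnn !orbT.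
  have iq : (msize q <= i)%N by rewrite /i !leq_max leqnn !orbT.
  rewrite !(sigmaE _ i) ?leq_maxl // -big_split; apply: eq_bigr => j _.
  by rewrite mcoeffD scalerDl.
have [->|c0] := eqVneq c 0; first by rewrite !scale0r /sigma msupp0 big_nil.
rewrite /sigma msuppMCX //.
by rewrite big_seq1 mcoeffZ mcoeffX eqxx mulr1.
Qed.

Lemma det_scale_cols (R : comNzRingType) n (F : 'I_n -> 'I_n -> R) (b : 'I_n -> R) :
  \det (\matrix_(s, t) (F s t * b t)) = \det (\matrix_(s, t) F s t) * \prod_t b t.
Proof.
have -> : \matrix_(s, t) (F s t * b t) = (\matrix_(s, t) F s t) *m diag_mx (\row_t b t).
  by rewrite mul_mx_diag; apply/matrixP => s t; rewrite !mxE.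
by rewrite det_mulmx det_diag; congr (_ * _); apply: eq_bigr => t _; rewrite mxE.
Qed.

Lemma mxvec_index_inj m n (x x' : 'I_m) (y y' : 'I_n) :
  mxvec_index x y = mxvec_index x' y' -> x = x' /\ y = y'.
Proof.
by rewrite /mxvec_index => /cast_ord_inj/enum_rank_inj[-> ->].
Qed.

Section Segre.
Variables (K : idomainType) (d l m : nat) (blk : 'I_m -> 'I_l).
Local Notation R := {mpoly K[d * m]}.
Local Notation N := (d * l + m)%N.
Local Notation T := {mpoly K[N]}.

Definition avar x j : 'I_N := lshift m (@mxvec_index d l x j).
Definition bvar y : 'I_N := rshift (d * l) y.
Let row_of (i : 'I_(d * m)) : 'I_d := mxvec (\matrix_(x < d, y < m) x) 0 i.
Let col_of (i : 'I_(d * m)) : 'I_m := mxvec (\matrix_(x < d, y < m) y) 0 i.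
Local Notation idx x y := (@mxvec_index d m x y).

(** The parametrisation [P x y = a x (blk y) * b y] of the matrices whose
    blocks have rank at most one. *)
Definition segre : {rmorphism R -> T} :=
  mpoly_subst [the {rmorphism K -> T} of @mpolyC N K]
        (fun i => 'X_(avar (row_of i) (blk (col_of i))) * 'X_(bvar (col_of i))).

Definition binomials : set R := [set p | exists x x' y y', blk y = blk y' /\
  p = 'X_(idx x y) * 'X_(idx x' y') - 'X_(idx x y') * 'X_(idx x' y)]%classic.

Let row_idx x y : row_of (idx x y) = x. Proof. by rewrite /row_of mxvecE mxE. Qed.
Let col_idx x y : col_of (idx x y) = y. Proof. by rewrite /col_of mxvecE mxE. Qed.
Let idxK i : idx (row_of i) (col_of i) = i.
Proof. by case/mxvec_indexP: i => x y; rewrite row_idx col_idx. Qed.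

Lemma segreX x y : segre 'X_(idx x y) = 'X_(avar x (blk y)) * 'X_(bvar y).
Proof. by rewrite substX row_idx col_idx. Qed.

Lemma avar_inj x j x' j' : avar x j = avar x' j' -> x = x' /\ j = j'.
Proof. by move/lshift_inj/mxvec_index_inj. Qed.

Let al i := avar (row_of i) (blk (col_of i)).
Let be i := bvar (col_of i).

Definition segre_mon (e : 'X_{1..d * m}) : 'X_{1..N} :=
  (\sum_i (U_(al i) + U_(be i)) *+ e i)%MM.

Lemma segre_monX e : segre 'X_[e] = 'X_[segre_mon e].
Proof.
rewrite mpolyXE_id rmorph_prod -mprodXnE; apply: eq_bigr => i _.
by rewrite rmorphXn /= substX mpolyXD.
Qed.

Lemma segre_monD e e' : segre_mon (e + e') = (segre_mon e + segre_mon e')%MM.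
Proof.
rewrite /segre_mon -big_split; apply: eq_bigr => i _ /=.
by apply/mnmP => z; rewrite mnmDE mulmnE !mnmDE !mulmnE !mnmDE mulnDr.
Qed.

Lemma segre_monU i : segre_mon U_(i) = (U_(al i) + U_(be i))%MM.
Proof.
rewrite /segre_mon (bigD1 i) //= mnm1E eqxx mulm1n big1 ?addm0 // => j ji.
by rewrite mnm1E eq_sym (negPf ji) mulm0n.
Qed.

Lemma segre_mon_gt0 e z : (0 < segre_mon e z)%N ->
  exists2 i, (0 < e i)%N & al i = z \/ be i = z.
Proof.
rewrite /segre_mon mnm_sumE lt0n sum_nat_eq0 => /forallPn[i].
rewrite mulmnE muln_eq0 negb_or mnmDE !mnm1E => /andP[h ei].
exists i; first by rewrite lt0n.
by move: h; have [->|_] := eqVneq (al i) z; [left | have [->|_] := eqVneq (be i) z; [right|]].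
Qed.

Lemma segre_mon_avar e x j : (0 < segre_mon e (avar x j))%N ->
  exists y, blk y = j /\ (0 < e (idx x y))%N.
Proof.
case/segre_mon_gt0 => i ei [/avar_inj[<- <-]|].
  by exists (col_of i); rewrite idxK.
by move/eqP; rewrite /be /bvar /avar eq_rlshift.
Qed.

Lemma segre_mon_bvar e y : (0 < segre_mon e (bvar y))%N ->
  exists x, (0 < e (idx x y))%N.
Proof.
case/segre_mon_gt0 => i ei [/eqP|/rshift_inj <-].
  by rewrite /al /bvar /avar eq_lrshift.
by exists (row_of i); rewrite idxK.
Qed.

Lemma mnm_split1 n (e : 'X_{1..n}) i : (0 < e i)%N -> exists e', e = (U_(i) + e')%MM.
Proof.
by rewrite lt0n -lep1mP => /submK ee; exists (e - U_(i))%MM; rewrite addmC ee.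
Qed.

Section Congruences.
Variables (I : set R) (idI : is_ideal I) (binI : (binomials `<=` I)%classic).

(** Pick a variable [p_{xy}] of [e].  The image of [e'] contains [a x (blk y)]
    and [b y], so [e'] contains some [p_{xy'}], with [y'] in the block of [y],
    and some [p_{x'y}].  One exchange makes [p_{xy}] appear in [e'], and it
    can then be cancelled on both sides. *)
Lemma segre_exchange e e' : segre_mon e = segre_mon e' -> I ('X_[e] - 'X_[e']).
Proof.
have [n] := ubnP (mdeg e); elim: n e e' => // n IHn e e' lt_en ee'.
have [e0|] := eqVneq e 0%MM.
  have -> : e' = e.
    apply/eqP; rewrite e0 -mdeg_eq0 mdegE sum_nat_eq0; apply/forallP => i.
    apply: contraT; rewrite implyTb -lt0n => /mnm_split1[f ef].
    move: ee'; rewrite e0 ef segre_monD segre_monU => /mnmP /(_ (al i)).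
    rewrite /segre_mon big1 => [|j _]; last by rewrite mnm0E mulm0n.
    by rewrite mnm0E !mnmDE mnm1E eqxx.
  by rewrite subrr; exact: (ideal_0 idI).
rewrite -mdeg_eq0 mdegE sum_nat_eq0 => /forallPn[i]; rewrite implyTb -lt0n.
case/mxvec_indexP: i => x y exy.
have [f ef] := mnm_split1 exy.
have main g : e' = (U_(idx x y) + g)%MM -> I ('X_[e] - 'X_[e']).
  move=> eg; rewrite ef eg !mpolyXD -mulrBr; apply: (ideal_Ml idI); apply: IHn.
    by rewrite ef mdegD mdeg1 in lt_en.
  by move: ee'; rewrite ef eg !segre_monD => /addmI.
have [y' [blk' exy']] : exists y', blk y' = blk y /\ (0 < e' (idx x y'))%N.
  apply: segre_mon_avar; rewrite -ee' ef segre_monD segre_monU /al row_idx col_idx.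
  by rewrite !mnmDE mnm1E eqxx.
have [x' ex'y] : exists x', (0 < e' (idx x' y))%N.
  apply: segre_mon_bvar; rewrite -ee' ef segre_monD segre_monU /be col_idx.
  by rewrite !mnmDE [U_(bvar y)%MM _]mnm1E eqxx addnAC addn1.
have [/mnm_split1[g /main //]|] := ltnP 0 (e' (idx x y)).
rewrite leqn0 => /eqP e'xy0.
have ne : idx x y' != idx x' y.
  apply/eqP => /mxvec_index_inj[ex ey]; move: ex'y.
  by rewrite -ex e'xy0.
have [g eg] := mnm_split1 exy'.
have [h eh] : exists h, g = (U_(idx x' y) + h)%MM.
  by apply: mnm_split1; move: ex'y; rewrite eg mnmDE mnm1E (negPf ne).
pose e'' := (U_(idx x y) + (U_(idx x' y') + h))%MM.
have bin : I ('X_[e''] - 'X_[e']).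
  rewrite eg eh /e'' !mpolyXD !mulrA -mulrBl; apply: (ideal_Mr idI).
  by apply: binI; exists x, x', y, y'.
have ee'' : segre_mon e'' = segre_mon e'.
  rewrite eg eh /e'' !segre_monD !segre_monU /al /be !row_idx !col_idx blk'.
  apply/mnmP => z; rewrite !mnmDE; ring.
rewrite -(subrK 'X_[e''] 'X_[e]) -addrA; apply: (ideal_D idI) => //.
rewrite ef /e'' !mpolyXD -mulrBr; apply: (ideal_Ml idI); rewrite -mpolyXD.
apply: IHn; first by rewrite ef mdegD mdeg1 in lt_en.
by move: ee'; rewrite -ee'' ef /e'' !(segre_monD U_(idx x y)) => /addmI.
Qed.

(** A linear section of [segre] modulo [I]: a monomial goes to a chosen
    preimage, or to 0 if it has none. *)
Lemma segre_section : exists sigma : T -> R,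
  [/\ forall p q, sigma (p + q) = sigma p + sigma q,
      forall c mu, (forall e, segre_mon e <> mu) -> sigma (c *: 'X_[mu]) = 0,
      forall c p, sigma (c *: p) = c *: sigma p &
      forall p, I (p - sigma (segre p))].
Proof.
have : forall mu, exists r : R, (forall e, segre_mon e = mu -> I ('X_[e] - r)) /\
    ((forall e, segre_mon e <> mu) -> r = 0).
  move=> mu; have [[e ee]|ne] := pselect (exists e, segre_mon e = mu).
    exists 'X_[e]; split=> [e' ee'|/(_ e)//].
    by apply: segre_exchange; rewrite ee.
  exists 0; split=> // e ee; by case: ne; exists e.
case/choice => s sP.
have [sigma [sD sX]] := mpoly_linear_extension s.
have s0 : sigma 0 = 0 by rewrite -(scale0r 'X_[0]) sX scale0r.
have sZ c p : sigma (c *: p) = c *: sigma p.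
  elim/mpolyind: p => [|a mu p _ _ IH]; first by rewrite scaler0 s0 scaler0.
  by rewrite scalerDr !sD IH scalerA !sX scalerDr scalerA.
exists sigma; split=> // [c mu nmu|p]; first by rewrite sX (sP mu).2 ?scaler0.
elim/mpolyind: p => [|c e p _ _ IH].
  by rewrite rmorph0 s0 subrr; exact: (ideal_0 idI).
rewrite rmorphD sD opprD addrACA; apply: (ideal_D idI) => //.
rewrite -mul_mpolyC rmorphM /= substC segre_monX /= !mul_mpolyC sX.
by rewrite -scalerBr -mul_mpolyC; apply: (ideal_Ml idI); apply: (sP _).1.
Qed.

Lemma segre_kernel p : segre p = 0 -> I p.
Proof.
have [sigma [sD _ _ sI]] := segre_section => p0.
have s0 : sigma 0 = 0 by apply: (addrI (sigma 0)); rewrite -sD !addr0.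
by move: (sI p); rewrite p0 s0 subr0.
Qed.

Hypothesis detI : forall (A : 'I_l -> 'I_d) (g : 'I_l -> 'I_m), (forall t, blk (g t) = t) ->
  I (\det (\matrix_(s, t) 'X_(idx (A s) (g t)))).

Lemma segre_det (A : 'I_l -> 'I_d) (g : 'I_l -> 'I_m) :
  segre (\det (\matrix_(s, t) 'X_(idx (A s) (g t)))) =
  \det (\matrix_(s, t) 'X_(avar (A s) (blk (g t)))) * \prod_t 'X_(bvar (g t)).
Proof.
rewrite -det_scale_cols -det_map_mx; congr (\det _).
by apply/matrixP => s t; rewrite !mxE segreX.
Qed.

(** It is enough that the section sends every multiple of a maximal minor of
    [a] into [I].  Consider a monomial times such a minor.  If none of its
    terms is the image of a monomial, the section kills it.  If one term is,
    the variables [a (A s) (w s)] in it come from variables of [P] in distinct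
    blocks; these provide factors [b y], one for each block, that belong to
    the monomial, and with them the minor becomes the image of a minor
    of [P]. *)
Lemma segre_maximal_minors p :
  ideal_gen (maximal_minors (fun x j => 'X_(avar x j) : T)) (segre p) -> I p.
Proof.
have [sigma [sD s0 sZ sI]] := segre_section => Gp.
have sig0 : sigma 0 = 0 by apply: (addrI (sigma 0)); rewrite -sD !addr0.
have ssum (J : finType) (F : J -> T) : sigma (\sum_i F i) = \sum_i sigma (F i).
  exact: (big_morph sigma sD sig0).
apply: (ideal_congr idI (b := sigma (segre p))) => //.
pose C := [set t | forall q, I (sigma (q * t))]%classic.
suff sub : (ideal_gen (maximal_minors (fun x j => 'X_(avar x j) : T)) `<=` C)%classic.
  by have := sub _ Gp 1; rewrite mul1r.
apply: ideal_gen_sub => [|_ [A ->]].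
  split=> [q|a b Ca Cb q|c a Ca q].
  - by rewrite mulr0 sig0; exact: (ideal_0 idI).
  - by rewrite mulrDr sD; exact: (ideal_D idI).
  - by rewrite mulrA.
set D := \det _ => q.
elim/mpolyind: q => [|c mu q _ _ IH].
  by rewrite mul0r sig0; exact: (ideal_0 idI).
rewrite mulrDl sD; apply: (ideal_D idI) => {q IH}//.
rewrite -scalerAl sZ -mul_mpolyC; apply: (ideal_Ml idI).
pose nu (w : 'S_l) := (mu + \sum_s U_(avar (A s) (w s)))%MM.
have nuE : 'X_[mu] * D = \sum_(w : 'S_l) (-1) ^+ w *: 'X_[nu w].
  rewrite /D /determinant mulr_sumr; apply: eq_bigr => w _.
  rewrite /nu mpolyXD -mprodXE mulrCA -mul_mpolyC rmorphXn rmorphN rmorph1.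
  by congr (_ * (_ * _)); apply: eq_bigr => s _; rewrite mxE.
have [[w [e ew]]|none] := pselect (exists w e, segre_mon e = nu w); last first.
  rewrite nuE ssum big1; first exact: (ideal_0 idI).
  move=> w _; apply: s0 => e ee.
  by apply: none; exists w, e.
have /choice[y yP] : forall s, exists y, blk y = w s /\ (0 < e (idx (A s) y))%N.
  move=> s; apply: segre_mon_avar; rewrite ew /nu mnmDE mnm_sumE (bigD1 s) //=.
  by rewrite mnm1E eqxx addnCA.
pose f := (\sum_s U_(idx (A s) (y s)))%MM.
have le_fe : (f <= e)%MM.
  apply/mnm_lepP => z; rewrite mnm_sumE.
  have [[s <-]|nz] := pselect (exists s, idx (A s) (y s) = z).
    rewrite (bigD1 s) //= mnm1E eqxx big1 ?addn0; first by case: (yP s).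
    move=> s' ss'; rewrite mnm1E; apply/eqP; rewrite eqb0; apply/eqP.
    move=> /mxvec_index_inj[_ ey]; case/negP: ss'; apply/eqP/(@perm_inj _ w).
    by rewrite -(yP s).1 -(yP s').1 ey.
  rewrite big1 // => s _; rewrite mnm1E; apply/eqP; rewrite eqb0; apply/eqP => ez.
  by apply: nz; exists s.
have [e' ee'] : exists e', e = (f + e')%MM.
  by exists (e - f)%MM; rewrite addmC submK.
have muE : mu = (\sum_s U_(bvar (y s)) + segre_mon e')%MM.
  have fE : segre_mon f =
      (\sum_s U_(bvar (y s)) + \sum_s U_(avar (A s) (w s)))%MM.
    have -> : segre_mon f = (\sum_s (segre_mon U_(idx (A s) (y s))))%MM.
      apply: (big_morph segre_mon segre_monD).
      by rewrite /segre_mon big1 // => i _; rewrite mnm0E mulm0n.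
    rewrite -big_split; apply: eq_bigr => s _ /=.
    by rewrite segre_monU /al /be row_idx col_idx (yP s).1 addmC.
  move: ew; rewrite ee' segre_monD fE /nu => ew.
  apply: (@addIm _ (\sum_s U_(avar (A s) (w s)))%MM); rewrite -ew.
  by apply/mnmP => z; rewrite !mnmDE addnAC.
pose g t := y ((w^-1)%g t).
have blkg t : blk (g t) = t by rewrite /g (yP _).1 permKV.
set r := 'X_[e'] * \det (\matrix_(s, t) ('X_(idx (A s) (g t)) : R)).
suff -> : 'X_[mu] * D = segre r.
  apply: (ideal_congr idI (b := r)); first exact: (ideal_BC idI (sI r)).
  by apply: (ideal_Ml idI); apply: detI.
rewrite rmorphM segre_det /= segre_monX muE mpolyXD -mprodXE.
have -> : \prod_t ('X_(bvar (g t)) : T) = \prod_s 'X_(bvar (y s)).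
  rewrite (reindex_inj (@perm_inj _ w)) /=; apply: eq_bigr => s _.
  by rewrite /g permK.
have -> : \matrix_(s, t) 'X_(avar (A s) (blk (g t))) =
          \matrix_(s, t) 'X_(avar (A s) t) :> 'M[T]_l.
  by apply/matrixP => s t; rewrite !mxE blkg.
rewrite -/D; ring.
Qed.

End Congruences.

End Segre.

(** * Minors indexed by functions *)

Lemma det_eq_cols (R : comNzRingType) n (M : 'M[R]_n) t t' :
  t != t' -> (forall s, M s t = M s t') -> \det M = 0.
Proof.
move=> tt' eM; rewrite -det_tr; apply: (determinant_alternate tt') => s.
by rewrite !mxE.
Qed.

Lemma det_2x2 (R : comNzRingType) (M : 'M[R]_2) :
  \det M = M 0 0 * M 1 1 - M 0 1 * M 1 0.
Proof.
have l01 : lift ord0 ord0 = 1 :> 'I_2 by apply: val_inj.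
have l10 : lift (1 : 'I_2) ord0 = 0 :> 'I_2 by apply: val_inj.
have cof i j : cofactor M i j = (-1) ^+ (i + j) * M (lift i ord0) (lift j ord0).
  by rewrite /cofactor det_mx11 !mxE.
rewrite (expand_det_row M ord0) !big_ord_recl big_ord0 !cof !l01 l10 addr0.
by rewrite expr0 mul1r expr1 mulN1r mulrN.
Qed.

(** Minors with unordered rows and columns: sorting them costs a sign. *)
Lemma minor_det (R : comNzRingType) m n (M : 'M[R]_(m, n)) (A : {set 'I_m})
    (B : {set 'I_n}) (eAB : #|A| = #|B|) p (f : 'I_p -> 'I_m) (g : 'I_p -> 'I_n) :
  p = #|A| -> injective f -> injective g ->
  (forall s, f s \in A) -> (forall t, g t \in B) ->
  exists b : bool, \det (\matrix_(s, t) M (f s) (g t)) = (-1) ^+ b * minor M eAB.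
Proof.
move=> ep; subst p => inj_f inj_g fA gB.
pose sf s := enum_rank_in (fA s) (f s).
pose sg t := cast_ord (esym eAB) (enum_rank_in (gB t) (g t)).
have sfK s : enum_val (sf s) = f s by rewrite enum_rankK_in.
have sgK t : enum_val (cast_ord eAB (sg t)) = g t by rewrite cast_ordKV enum_rankK_in.
have inj_sf : injective sf by move=> s s' e; apply: inj_f; rewrite -!sfK e.
have inj_sg : injective sg by move=> t t' e; apply: inj_g; rewrite -!sgK e.
exists (odd_perm (perm inj_sf) (+) odd_perm (perm inj_sg)).
pose N := \matrix_(s < #|A|, t < #|A|) M (enum_val s) (enum_val (cast_ord eAB t)).
have -> : \matrix_(s, t) M (f s) (g t) = row_perm (perm inj_sf) (col_perm (perm inj_sg) N).
  by apply/matrixP => s t; rewrite !mxE !permE sfK sgK.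
rewrite /minor -/N row_permE col_permE !det_mulmx !det_perm odd_permV signr_addb.
by rewrite [\det N * _]mulrC mulrA.
Qed.

Lemma minor_fun (R : comNzRingType) m n (M : 'M[R]_(m, n)) (A : {set 'I_m})
    (B : {set 'I_n}) (eAB : #|A| = #|B|) p : #|A| = p ->
  exists (f : 'I_p -> 'I_m) (g : 'I_p -> 'I_n),
    [/\ injective f, injective g, forall t, g t \in B,
        forall y, y \in B -> exists t, g t = y &
        minor M eAB = \det (\matrix_(s, t) M (f s) (g t))].
Proof.
move=> ep; subst p; exists enum_val, (fun t => enum_val (cast_ord eAB t)).
split=> //; first exact: enum_val_inj.
- by move=> t t' /enum_val_inj/cast_ord_inj.
- by move=> t; apply: enum_valP.
- move=> y yB; exists (cast_ord (esym eAB) (enum_rank_in yB y)).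
  by rewrite cast_ordKV enum_rankK_in.
Qed.

(** * The arrangement of the columns *)

Section Blocks.
Variables (k l : nat).

Lemma blk_subproof (y : 'I_(k * l)) : (y %/ k < l)%N.
Proof.
have k0 : (0 < k)%N by case: k y => [[]|].
rewrite ltn_divLR //; apply: (leq_trans (ltn_ord y)); by rewrite mulnC.
Qed.

Definition blk (y : 'I_(k * l)) : 'I_l := Ordinal (blk_subproof y).

Lemma blkY i j : blk (Y i j) = j.
Proof.
apply: val_inj => /=; have k0 : (0 < k)%N by case: (k) i => [[]|].
by rewrite divnMDl // divn_small // addn0.
Qed.

Lemma Y_surj y : exists i, Y i (blk y) = y.
Proof.
have k0 : (0 < k)%N by case: (k) y => [[]|].
exists (Ordinal (ltn_pmod y k0)); apply: val_inj => /=.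
by rewrite -divn_eq.
Qed.

Lemma Y_inj i j i' j' : Y i j = Y i' j' :> 'I_(k * l) -> i = i' /\ j = j'.
Proof.
move=> e; have ej : j = j' by rewrite -(blkY i j) e blkY.
split=> //; move/(congr1 val): e => /=; rewrite ej => /addnI; exact: val_inj.
Qed.

Lemma in_Ycol y j : (y \in Ycol k j) = (blk y == j).
Proof.
apply/imsetP/eqP => [[i _ ->]|<-]; first exact: blkY.
by have [i iy] := Y_surj y; exists i.
Qed.

Lemma card_Yrow (i : 'I_k) : #|Yrow l i| = l.
Proof. by rewrite card_imset ?card_ord // => j j' /Y_inj[]. Qed.

Lemma calL_Yrow (S : {set 'I_(k * l)}) i : S \in calL k l -> exists j, Y i j \in S.
Proof.
case/imsetP => h; rewrite inE => /andP[/eqP h1 _] ->.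
have : i \in [set (h t).1 | t : 'I_k]%SET.
  suff -> : [set (h t).1 | t : 'I_k]%SET = [set: 'I_k]%SET by rewrite inE.
  by apply/eqP; rewrite eqEcard finset.subsetT cardsT card_ord h1 /=.
by case/imsetP => t _ ->; exists (h t).2; apply/imsetP; exists t.
Qed.

Lemma calL_fst_inj (h : {ffun 'I_k -> 'I_k * 'I_l}) :
  #|[set (h t).1 | t : 'I_k]%SET| = k -> injective (fun t => (h t).1).
Proof.
move=> h1 t t' e; have /imset_injP inj :
    #|[set (h t).1 | t : 'I_k]%SET| == #|'I_k| by rewrite h1 card_ord.
by apply: inj.
Qed.

Lemma calL_card (S : {set 'I_(k * l)}) : S \in calL k l -> #|S| = k.
Proof.
case/imsetP => h; rewrite inE => /andP[/eqP /calL_fst_inj h1 _] ->.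
by rewrite card_imset ?card_ord // => t t' /Y_inj[/h1].
Qed.

Lemma calL_Ycol (S : {set 'I_(k * l)}) j : S \in calL k l -> exists i, Y i j \notin S.
Proof.
case/imsetP => h; rewrite inE => /andP[/eqP /calL_fst_inj h1 h2] ->.
apply: contrapT => no; move: h2; rewrite leqNgt => /negP; apply.
rewrite ltnS -(cards1 j) subset_leq_card //.
apply/fintype.subsetP => _ /imsetP[t _ ->]; rewrite inE.
have /imsetP[t' _ /Y_inj[e ->]] : Y (h t).1 j \in
    [set Y (h t).1 (h t).2 | t : 'I_k]%SET.
  by apply: contrapT => /negP n; apply: no; exists (h t).1.
by rewrite (h1 _ _ e).
Qed.

End Blocks.

(** * The components are prime *)
Section Points.
Variables (K : idomainType) (d l m : nat).
Local Notation T := {mpoly K[d * l + m]}.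

Lemma abvar_ind (Q : 'I_(d * l + m) -> Prop) :
  (forall x j, Q (avar m x j)) -> (forall y, Q (@bvar d l m y)) -> forall i, Q i.
Proof.
move=> Qa Qb i; rewrite -[i]splitK; case: (split i) => [z|y] /=; last exact: Qb.
by case/mxvec_indexP: z => x j; apply: Qa.
Qed.

Lemma point_exists (D : comNzRingType) (c : {rmorphism K -> D})
    (a : 'I_d -> 'I_l -> D) (b : 'I_m -> D) :
  exists th : {rmorphism T -> D},
    [/\ forall z, th z%:MP = c z, forall x j, th 'X_(avar m x j) = a x j &
        forall y, th 'X_(@bvar d l m y) = b y].
Proof.
pose v i := match split i with
  | inl z => mxvec (\matrix_(x, j) a x j) 0 z | inr y => b y end.
exists (mpoly_subst c v); split=> [z|x j|y]; rewrite ?substC // substX /v.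
  by rewrite /avar (unsplitK (inl _ _)) mxvecE mxE.
by rewrite /bvar (unsplitK (inr _ _)).
Qed.

Lemma point_ext (D : comNzRingType) (th th' : {rmorphism T -> D}) :
  (forall z, th z%:MP = th' z%:MP) ->
  (forall x j, th 'X_(avar m x j) = th' 'X_(avar m x j)) ->
  (forall y, th 'X_(@bvar d l m y) = th' 'X_(@bvar d l m y)) -> th =1 th'.
Proof. by move=> eC ea eb; apply: mpoly_morph_ext => //; apply: abvar_ind. Qed.

End Points.

(** A matrix with dependent columns factors through a hyperplane of the space
    of coefficients. *)
Lemma dependent_factor (F : fieldType) d l (a : 'I_d -> 'I_l -> F) : dependent a ->
  exists (u : 'I_d -> 'I_l -> F) (w : 'I_l -> 'I_l -> F),
    forall x j, a x j = \sum_(s < l | (0 < s)%N) u x s * w s j.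
Proof.
case=> c [[j0 cj0] ac].
pose o := Ordinal (leq_ltn_trans (leq0n j0) (ltn_ord j0)).
pose N s j := (s == j)%:R - (if j == j0 then c s / c j0 else 0).
exists (fun x s => a x (tperm o j0 s)), (fun s => N (tperm o j0 s)) => x j.
have aN : a x j = \sum_s a x s * N s j.
  have e1 : \sum_s a x s * (s == j)%:R = a x j.
    rewrite (bigD1 j) //= eqxx mulr1 big1 ?addr0 // => s /negPf ->.
    by rewrite mulr0.
  have e2 : \sum_s a x s * (if j == j0 then c s / c j0 else 0) = 0.
    case: (j == j0); last by rewrite big1 // => s; rewrite mulr0.
    under eq_bigr => s _ do rewrite mulrA.
    by rewrite -mulr_suml ac mul0r.
  transitivity (\sum_s a x s * (s == j)%:R -
                \sum_s a x s * (if j == j0 then c s / c j0 else 0)).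
    by rewrite e1 e2 subr0.
  by rewrite -sumrB; apply: eq_bigr => s _; rewrite /N mulrBr.
rewrite aN (reindex_inj (@perm_inj _ (tperm o j0))) /= (bigD1 o) //=.
rewrite tpermL {1}/N eq_sym; set z := a x j0 * _; have -> : z = 0.
  by rewrite /z; case: ifP => _; rewrite ?divff // subrr ?mulr0.
by rewrite add0r; apply: eq_bigl => s; rewrite lt0n.
Qed.

Section Components.
Variables (K : fieldType) (k l d : nat).
Local Notation m := (k * l)%N.
Local Notation R := {mpoly K[d * m]}.
Local Notation T := {mpoly K[d * l + m]}.
Local Notation P := (generic_mx K d m).
Local Notation phi := (segre K d (@blk k l)).
Local Notation J2 := (ideal_gen (@col_2minors K k l d)).

Let idJ2 : is_ideal J2 := ideal_gen_ideal _.

Lemma phiP x y : phi (P x y) = 'X_(avar m x (blk y)) * 'X_(bvar d l y).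
Proof. by rewrite mxE segreX. Qed.

Lemma phi_det p (f : 'I_p -> 'I_d) (g : 'I_p -> 'I_m) :
  phi (\det (\matrix_(s, t) P (f s) (g t))) =
  \det (\matrix_(s, t) 'X_(avar m (f s) (blk (g t)))) * \prod_t 'X_(bvar d l (g t)).
Proof.
rewrite -det_scale_cols -det_map_mx; congr (\det _).
by apply/matrixP => s t; rewrite !mxE segreX.
Qed.

Lemma phi_det0 p (f : 'I_p -> 'I_d) (g : 'I_p -> 'I_m) t t' :
  t != t' -> blk (g t) = blk (g t') ->
  phi (\det (\matrix_(s, t) P (f s) (g t))) = 0.
Proof.
move=> tt' e; rewrite phi_det (det_eq_cols tt') ?mul0r // => s.
by rewrite !mxE e.
Qed.

(** Repeated rows or columns give a zero determinant, so only injective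
    indexings have to be examined. *)
Lemma minor_in (X : {set 'I_d} -> {set 'I_m} -> Prop) p
    (f : 'I_p -> 'I_d) (g : 'I_p -> 'I_m) :
  (injective f -> injective g -> X [set f s | s : 'I_p]%SET [set g t | t : 'I_p]%SET) ->
  ideal_gen (minors P X) (\det (\matrix_(s, t) P (f s) (g t))).
Proof.
have idX := ideal_gen_ideal (minors P X) => hX.
have [inj_f|] := pselect (injective f); last first.
  move=> /existsNP[s] /existsNP[s'] /not_implyP[e /eqP ss'].
  rewrite (determinant_alternate ss') => [|t]; first exact: (ideal_0 idX).
  by rewrite !mxE e.
have [inj_g|] := pselect (injective g); last first.
  move=> /existsNP[t] /existsNP[t'] /not_implyP[e /eqP tt'].
  rewrite (det_eq_cols tt') => [|s]; first exact: (ideal_0 idX).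
  by rewrite !mxE e.
have cA : #|[set f s | s : 'I_p]%SET| = p by rewrite card_imset ?card_ord.
have cB : #|[set g t | t : 'I_p]%SET| = p by rewrite card_imset ?card_ord.
have eAB := etrans cA (esym cB).
have fA s : f s \in [set f s | s : 'I_p]%SET by apply: imset_f.
have gB t : g t \in [set g t | t : 'I_p]%SET by apply: imset_f.
have [b ->] := @minor_det R _ _ P _ _ eAB p f g (esym cA) inj_f inj_g fA gB.
apply: (ideal_Ml idX); apply: ideal_gen_in.
by exists [set f s | s : 'I_p]%SET, [set g t | t : 'I_p]%SET, eAB; split=> //; apply: hX.
Qed.

Lemma binomials_J2 : (@binomials K d l m (@blk k l) `<=` J2)%classic.
Proof.
move=> _ [x [x' [y [y' [e ->]]]]].
pose f (s : 'I_2) := if s == 0 then x else x'.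
pose g (t : 'I_2) := if t == 0 then y else y'.
have -> : 'X_(mxvec_index x y) * 'X_(mxvec_index x' y') -
    'X_(mxvec_index x y') * 'X_(mxvec_index x' y) =
    \det (\matrix_(s, t) P (f s) (g t)) :> R.
  by rewrite det_2x2 !mxE.
apply: minor_in => inj_f inj_g; split; last 2 first.
- by rewrite card_imset ?card_ord.
- by rewrite card_imset ?card_ord.
exists (blk y); apply/fintype.subsetP => _ /imsetP[t _ ->].
by rewrite in_Ycol /g; case: ifP => _ //; rewrite e.
Qed.

Lemma phi_kernel f : phi f = 0 -> J2 f.
Proof. exact: (segre_kernel idJ2 binomials_J2). Qed.

Lemma J2_phi f : J2 f -> phi f = 0.
Proof.
move: f; apply: ideal_gen_sub => [|_ [A [B [eAB [[[j Bj] A2 B2] ->]]]]].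
  exact: (ideal_ker phi).
have [f [g [_ _ gB _ ->]]] := minor_fun P eAB A2.
apply: (@phi_det0 _ f g 0 1) => //.
have blkg t : blk (g t) = j.
  by apply/eqP; rewrite -in_Ycol; apply: (fintype.subsetP Bj).
by rewrite !blkg.
Qed.

Section ComponentS.
Variable S : {set 'I_m}.

Lemma point_S_key : exists th : {rmorphism T -> T},
    [/\ forall z, th z%:MP = z%:MP,
        forall x j, th 'X_(avar m x j) = 'X_(avar m x j) &
        forall y, th 'X_(bvar d l y) = if y \in S then 0 else 'X_(bvar d l y)].
Proof. exact: (point_exists [the {rmorphism K -> T} of @mpolyC _ K]). Qed.

(** The generic point of the variety of [I_ S], in the coordinates [a], [b]. *)
Definition point_S : {rmorphism T -> T} := sval (cid point_S_key).
Definition phi_S : {rmorphism R -> T} := [the {rmorphism R -> T} of point_S \o phi].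

Lemma phi_SP x y :
  phi_S (P x y) = if y \in S then 0 else 'X_(avar m x (blk y)) * 'X_(bvar d l y).
Proof.
rewrite /= phiP rmorphM /point_S; case: cid => /= th [_ -> ->].
by case: ifP; rewrite ?mulr0.
Qed.

Lemma phi_SC z : phi_S z%:MP = z%:MP.
Proof. by rewrite /= substC /point_S; case: cid => /= th [-> _ _]. Qed.

Lemma I_S_ideal : is_ideal (I_ K d S).
Proof. by apply: ideal_add_ideal; apply: ideal_gen_ideal. Qed.

Lemma I_S_var x y : y \in S -> I_ K d S (P x y).
Proof.
move=> yS; apply: ideal_add_l; first exact: idJ2.
by apply: ideal_gen_in; exists x, y.
Qed.

(** Modulo the entries in the columns [S] a polynomial may be assumed not to
    contain them; it is then in the kernel of [segre]. *)
Lemma I_S_kernel : I_ K d S = [set f | phi_S f = 0]%classic.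
Proof.
apply/seteqP; split.
  apply: ideal_add_sub; first exact: (ideal_ker phi_S).
    apply: ideal_gen_sub; first exact: (ideal_ker phi_S).
    by move=> _ [x [y [yS ->]]]; apply: (etrans (phi_SP x y)); rewrite yS.
  by move=> f /J2_phi /= ->; rewrite rmorph0.
move=> f /= f0.
pose J := [pred i | [exists x, exists y, (y \in S) && (i == @mxvec_index d m x y)]].
have JP x y : J (mxvec_index x y) = (y \in S).
  apply/existsP/idP => [[x' /existsP[y' /andP[yS /eqP/mxvec_index_inj[_ ->]]]]|yS] //.
  by exists x; apply/existsP; exists y; rewrite yS eqxx.
apply: (ideal_congr I_S_ideal (b := kill K J f)).
  apply: kill_congr => [|i /existsP[x /existsP[y /andP[yS /eqP ->]]]].
    exact: I_S_ideal.
  by have := I_S_var x yS; rewrite mxE.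
apply: ideal_add_r; first exact: ideal_gen_ideal.
apply: phi_kernel; rewrite -[RHS]f0 -[RHS]/(phi_S f).
have /(_ f) // : [the {rmorphism R -> T} of phi \o kill K J] =1 phi_S.
apply: mpoly_morph_ext => [z|i].
  by rewrite phi_SC /= !substC.
case/mxvec_indexP: i => x y; have := phi_SP x y; rewrite mxE => ->.
rewrite /= killX JP; case: ifP => _; first by rewrite rmorph0.
by rewrite segreX.
Qed.

End ComponentS.

Section Component0.

Let J := ('I_d * 'I_l + 'I_l * 'I_l + 'I_m)%type.
Local Notation E := {mpoly K[#|{: J}|]}.
Let uvar x s : E := 'X_(enum_rank (inl (inl (x, s)) : J)).
Let wvar s j : E := 'X_(enum_rank (inl (inr (s, j)) : J)).
Let cvar y : E := 'X_(enum_rank (inr y : J)).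

(** The factor with variables [wvar] has [l] rows, of which row 0 is omitted:
    products of this form are the matrices that factor through rank [l - 1]. *)
Lemma point_0_key : exists th : {rmorphism T -> E},
    [/\ forall z, th z%:MP = z%:MP,
        forall x j, th 'X_(avar m x j) = \sum_(s < l | (0 < s)%N) uvar x s * wvar s j &
        forall y, th 'X_(bvar d l y) = cvar y].
Proof. exact: (point_exists [the {rmorphism K -> E} of @mpolyC _ K]). Qed.

Definition point_0 : {rmorphism T -> E} := sval (cid point_0_key).
Definition phi_0 : {rmorphism R -> E} := [the {rmorphism R -> E} of point_0 \o phi].

(** [point_0] is generic: over a field every point whose columns are dependent
    factors through it. *)
Lemma point_0_univ (F : fieldType) (th : {rmorphism T -> F}) :
  dependent (fun x j => th 'X_(avar m x j)) ->
  exists eta : {rmorphism E -> F}, forall p, eta (point_0 p) = th p.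
Proof.
move=> /dependent_factor[u [w uw]].
pose v (z : J) := match z with
  | inl (inl (x, s)) => u x s
  | inl (inr (s, j)) => w s j
  | inr y => th 'X_(bvar d l y) end.
pose c := [the {rmorphism K -> F} of th \o @mpolyC _ K].
pose eta : {rmorphism E -> F} := mpoly_subst c (fun i => v (enum_val i)).
have etaX z : eta 'X_(enum_rank z) = v z by rewrite substX enum_rankK.
exists eta; have : [the {rmorphism T -> F} of eta \o point_0] =1 th; last by [].
rewrite /point_0; case: cid => /= th0 [thC tha thb].
apply: point_ext => [z|x j|y] /=.
- by rewrite thC substC.
- rewrite tha rmorph_sum uw; apply: eq_bigr => s _.
  by rewrite rmorphM /= !etaX.
- by rewrite thb etaX.
Qed.

Lemma I_0_ideal : is_ideal (I_0 K k l d).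
Proof. by apply: ideal_add_ideal; apply: ideal_gen_ideal. Qed.

Lemma I_0_det (f : 'I_l -> 'I_d) (g : 'I_l -> 'I_m) :
  I_0 K k l d (\det (\matrix_(s, t) P (f s) (g t))).
Proof.
apply: ideal_add_r; first exact: idJ2.
by apply: minor_in => inj_f inj_g; rewrite !card_imset ?card_ord.
Qed.

Lemma point_0_det (f : 'I_l -> 'I_d) (g : 'I_l -> 'I_l) : (0 < l)%N ->
  point_0 (\det (\matrix_(s, t) 'X_(avar m (f s) (g t)))) = 0.
Proof.
move=> l0; rewrite -det_map_mx.
pose U := \matrix_(s, r) uvar (f s) r.
pose W := \matrix_(r < l, t < l) (if (0 < r)%N then wvar r (g t) else 0).
set M := map_mx _ _; have -> : M = U *m W.
  apply/matrixP => s t; rewrite !mxE /point_0; case: cid => /= th [_ -> _].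
  rewrite big_mkcond; apply: eq_bigr => r _; rewrite !mxE.
  by case: ifP; rewrite ?mulr0.
rewrite det_mulmx (expand_det_row W (Ordinal l0)) big1 ?mulr0 // => t _.
by rewrite mxE mul0r.
Qed.

(** The factorisation of [point_0_univ] needs a field, so points over a domain
    are moved to its field of fractions. *)
Lemma I_0_kernel : (0 < l)%N -> I_0 K k l d = [set f | phi_0 f = 0]%classic.
Proof.
move=> l0; apply/seteqP; split.
  apply: ideal_add_sub; first exact: (ideal_ker phi_0).
    by move=> f /J2_phi /= ->; rewrite rmorph0.
  apply: ideal_gen_sub; first exact: (ideal_ker phi_0).
  move=> _ [A [B [eAB [[Al Bl] ->]]]].
  have [f [g [_ _ _ _ ->]]] := minor_fun P eAB Al.
  rewrite /= phi_det rmorphM point_0_det ?mul0r //.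
move=> f /= f0.
apply: (segre_maximal_minors I_0_ideal) => [p /binomials_J2|A g _|].
- by apply: ideal_add_l; apply: ideal_gen_ideal.
- have := I_0_det A g; congr (I_0 _ _ _ _ (\det _)).
  by apply/matrixP => s t; rewrite !mxE.
apply: maximal_minors_vanishing => [|D th [c [[j cj] ac]]]; first exact: avar_inj.
pose th' := [the {rmorphism T -> {fraction D}} of (@tofrac D) \o th].
have [|eta etaP] := @point_0_univ _ th'.
  exists (fun j => tofrac (c j)); split; first by exists j; rewrite tofrac_eq0.
  move=> x; rewrite -[RHS]tofrac0 -(ac x) rmorph_sum.
  by apply: eq_bigr => i _; rewrite rmorphM.
apply/eqP; rewrite -tofrac_eq0 -[tofrac _]/(th' _) -etaP.
by rewrite [point_0 _]f0 rmorph0.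
Qed.

End Component0.

End Components.

(** * Primes containing [J_Delta] *)
Section Decomposition.
Variables (K : fieldType) (k l d : nat).
Local Notation m := (k * l)%N.
Local Notation R := {mpoly K[d * m]}.
Local Notation P := (generic_mx K d m).
Local Notation J := (J_Delta K k l d).

Lemma J2_sub_J : (ideal_gen (@col_2minors K k l d) `<=` J)%classic.
Proof.
apply: ideal_gen_sub; first exact: ideal_gen_ideal.
move=> _ [A [B [eAB [[[j Bj] A2 B2] ->]]]]; apply: ideal_gen_in.
exists A, B, eAB; split=> //; rewrite finset.inE; apply/orP; left.
by apply/bigcupP; exists j => //; rewrite finset.inE Bj B2 eqxx.
Qed.

Lemma J_sub (M : set R) : is_ideal M ->
  (ideal_gen (@col_2minors K k l d) `<=` M)%classic ->
  (forall (A : {set 'I_d}) (i : 'I_k) (e : #|A| = #|Yrow l i|), M (minor P e)) -> (J `<=` M)%classic.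
Proof.
move=> idM J2M rowM; apply: ideal_gen_sub => //.
move=> _ [A [B [eAB [DB ->]]]]; move: DB eAB; rewrite finset.inE => /orP[].
  case/bigcupP => j _; rewrite finset.inE => /andP[Bj /eqP B2] eAB.
  apply: J2M; apply: ideal_gen_in; exists A, B, eAB; split=> //; split=> //.
    by exists j.
  by rewrite eAB.
by case/imsetP => i _ -> eAB; apply: rowM.
Qed.

Lemma J_sub_I_0 : (J `<=` I_0 K k l d)%classic.
Proof.
apply: J_sub => [||A i e]; first exact: I_0_ideal.
  by apply: ideal_add_l; apply: ideal_gen_ideal.
apply: ideal_add_r; first exact: ideal_gen_ideal.
apply: ideal_gen_in; exists A, (Yrow l i), e; split=> //.
by rewrite e card_Yrow.
Qed.

Lemma J_sub_I_S (S : {set 'I_m}) : S \in calL k l -> (J `<=` I_ K d S)%classic.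
Proof.
move=> LS; apply: J_sub => [||A i e]; first exact: I_S_ideal.
  by apply: ideal_add_r; apply: ideal_gen_ideal.
have [f [g [_ _ _ gY ->]]] := minor_fun P e erefl.
have [j Sij] := calL_Yrow i LS.
have [t gt] : exists t, g t = Y i j by apply: gY; apply/imsetP; exists j.
apply: (ideal_det_col (I_S_ideal K d S) (j := t)) => s.
by rewrite [X in I_ _ _ _ X]mxE gt; apply: I_S_var.
Qed.

(** With [h t] the column of row [i] in the block of [g t], and [x] arbitrary,
    [det (P (f s) (g t)) * \prod_t P (x t) (h t)] and
    [det (P (f s) (h t)) * \prod_t P (x t) (g t)] have the same image under
    [segre], and the second one is in [J_Delta]. *)
Lemma prime_contains_component (p : set R) : (0 < k)%N -> prime_ideal p ->
  (J `<=` p)%classic -> ~ (I_0 K k l d `<=` p)%classic ->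
  exists2 S, S \in calL k l & (I_ K d S `<=` p)%classic.
Proof.
move=> k0 pp Jp nI0; have [idp p1 pM] := pp.
have J2p : (ideal_gen (@col_2minors K k l d) `<=` p)%classic.
  by move=> f /J2_sub_J /Jp.
have kerp f : segre K d (@blk k l) f = 0 -> p f by move=> /phi_kernel /J2p.
have [f [g nfg]] : exists (f : 'I_l -> 'I_d) (g : 'I_l -> 'I_m),
    ~ p (\det (\matrix_(s, t) P (f s) (g t))).
  apply: contrapT => no; apply: nI0; apply: ideal_add_sub => //.
  apply: ideal_gen_sub => // _ [A [B [eAB [[Al _] ->]]]].
  have [f [g [_ _ _ _ ->]]] := minor_fun P eAB Al.
  by apply: contrapT => nfg; apply: no; exists f, g.
have blkg_inj : injective (fun t => blk (g t)).
  move=> t t' e; apply: contrapT => /eqP tt'; apply: nfg; apply: kerp.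
  exact: (phi_det0 _ _ tt').
have colp (i : 'I_k) : exists j : 'I_l, forall x, p (P x (Y i j)).
  apply: contrapT => no.
  have /choice[x xP] : forall t, exists x, ~ p (P x (Y i (blk (g t)))).
    move=> t; apply: contrapT => no'; apply: no; exists (blk (g t)) => x.
    by apply: contrapT => np; apply: no'; exists x.
  have : p (\det (\matrix_(s, t) P (f s) (g t)) * \prod_t P (x t) (Y i (blk (g t)))).
    set h := fun t => Y i (blk (g t)).
    apply: (ideal_congr idp (b := \det (\matrix_(s, t) P (f s) (h t)) *
                                  \prod_t P (x t) (g t))); last first.
      apply: (ideal_Mr idp); apply: Jp; apply: minor_in => _ inj_h.
      have -> : [set h t | t : 'I_l]%SET = Yrow l i.
        apply/eqP; rewrite eqEcard card_Yrow (card_imset _ inj_h) card_ord leqnn andbT.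
        by apply/fintype.subsetP => _ /imsetP[t _ ->]; apply: imset_f.
      by rewrite finset.inE; apply/orP; right; apply: imset_f.
    have phi_prod g' : (forall t, blk (g' t) = blk (g t)) ->
        segre K d (@blk k l) (\prod_t P (x t) (g' t)) =
        \prod_t 'X_(avar m (x t) (blk (g t))) * \prod_t 'X_(bvar d l (g' t)).
      move=> eg; rewrite rmorph_prod -big_split; apply: eq_bigr => t _ /=.
      by rewrite phiP eg.
    have blkh t : blk (h t) = blk (g t) by rewrite /h blkY.
    apply: kerp; rewrite rmorphB !rmorphM !phi_det !phi_prod //.
    have -> : \matrix_(s, t) 'X_(avar m (f s) (blk (h t))) =
        \matrix_(s, t) 'X_(avar m (f s) (blk (g t))) :> 'M[{mpoly K[d * l + m]}]_l.
      by apply/matrixP => s t; rewrite !mxE blkh.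
    ring.
  case/pM => // /(prime_prod pp)[t _]; exact: xP.
have [h hP] := choice colp.
(* If [h] is constant, its value is the block of some column [g t] of the
   minor, and that column is the selected one in its row. *)
have [two|one] := boolP (2 <= #|[set h t | t : 'I_k]%SET|)%N; last first.
  exfalso; pose i0 := Ordinal k0.
  have hc i : h i = h i0.
    apply: contraNeq one => ne.
    have <- : #|[set h i; h i0]%SET| = 2%N by rewrite cards2 ne.
    apply: subset_leq_card; apply/fintype.subsetP => z.
    by rewrite !finset.inE => /orP[] /eqP ->; apply: imset_f.
  have [t gt] : exists t, blk (g t) = h i0.
    have [s _ sK] := injF_bij blkg_inj.
    by exists (s (h i0)).
  have [i gi] := Y_surj (g t).
  apply: nfg; apply: (ideal_det_col idp (j := t)) => s.
  by rewrite [X in p X]mxE -gi gt -(hc i); apply: hP.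
exists [set Y t (h t) | t : 'I_k]%SET.
  apply/imsetP; exists [ffun t => (t, h t)].
    rewrite finset.inE; apply/andP; split.
      rewrite card_imset ?card_ord // => t t'; by rewrite !ffunE.
    suff -> : [set ([ffun t => (t, h t)] t).2 | t : 'I_k]%SET = [set h t | t : 'I_k]%SET by [].
    by apply: eq_imset => t; rewrite ffunE.
  by apply: eq_imset => t; rewrite ffunE.
apply: ideal_add_sub => //; apply: ideal_gen_sub => // _ [x [y [/imsetP[t _ ->] ->]]].
exact: hP.
Qed.

Lemma radical_J : (0 < k)%N -> (0 < l)%N ->
  radical J = (I_0 K k l d `&` \bigcap_(S in [set S | S \in calL k l]) I_ K d S)%classic.
Proof.
move=> k0 l0.
have p0 : prime_ideal (I_0 K k l d) by rewrite I_0_kernel //; apply: prime_ker.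
have pS (S : {set 'I_m}) : prime_ideal (I_ K d S) by rewrite I_S_kernel; apply: prime_ker.
apply/seteqP; split=> [f [n Jf]|f [f0 fS]].
  split; first by apply: (prime_exp (n := n) p0); apply: J_sub_I_0.
  move=> S LS. exact: (prime_exp (pS S) (J_sub_I_S LS Jf)).
apply: contrapT => nJf.
have [p pp [Jp pf]] := prime_avoiding (ideal_gen_ideal _) nJf.
have [I0p|nI0p] := pselect (I_0 K k l d `<=` p)%classic; first exact/pf/I0p.
have [S LS ISp] := prime_contains_component k0 pp Jp nI0p.
by apply/pf/ISp/fS.
Qed.

Lemma I_S_not_sub_I_S S S' : (0 < d)%N -> S \in calL k l -> S' \in calL k l ->
  S != S' -> ~ (I_ K d S `<=` I_ K d S')%classic.
Proof.
move=> d0 LS LS' ne.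
have [y yS yS'] : exists2 y, y \in S & y \notin S'.
  apply/subsetPn; apply: contra ne => sub.
  by rewrite eqEcard sub (calL_card LS) (calL_card LS') leqnn.
move=> /(_ _ (I_S_var K (Ordinal d0) yS)); rewrite I_S_kernel => /= /eqP.
rewrite -[X in X == 0]/(phi_S K d S' _) phi_SP (negPf yS') -mpolyXD.
set e := (_ + _)%MM; apply/negP; apply: contra_neq (oner_neq0 K).
by move/(congr1 (mcoeff e)); rewrite mcoeffX eqxx mcoeff0.
Qed.

(** The matrix with all entries 1 has dependent columns. *)
Lemma I_S_not_sub_I_0 S : (0 < k)%N -> (1 < l)%N -> (0 < d)%N -> S \in calL k l ->
  ~ (I_ K d S `<=` I_0 K k l d)%classic.
Proof.
move=> k0 l1 d0 LS.
have [y yS] : exists y, y \in S.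
  by have [j jS] := calL_Yrow (Ordinal k0) LS; exists (Y (Ordinal k0) j).
move=> /(_ _ (I_S_var K (Ordinal d0) yS)); rewrite I_0_kernel ?(ltnW l1) //= => /eqP.
pose s1 := Ordinal l1.
have [th [thC tha thb]] := point_exists (idfun : {rmorphism K -> K})
  (fun (_ : 'I_d) (_ : 'I_l) => 1) (fun (_ : 'I_m) => 1).
have [|eta etaP] := @point_0_univ K k l d K th.
  exists (fun j => (j == s1)%:R - (j == Ordinal (ltnW l1))%:R); split.
    exists s1; rewrite eqxx (_ : (s1 == _) = false) // subr0; exact: oner_neq0.
  move=> x; under eq_bigr => j _ do rewrite tha mul1r.
  rewrite sumrB (bigD1 s1) //= ?eqxx big1 ?addr0 => [|j /negPf -> //].
  by rewrite (bigD1 (Ordinal (ltnW l1))) //= ?eqxx big1 ?addr0 ?subrr // => j /negPf ->.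
apply/negP; apply: contra_neq (oner_neq0 K) => /(congr1 eta).
by rewrite etaP phiP rmorphM tha thb mulr1 rmorph0.
Qed.

(** No element of [calL] contains a whole block, so some maximal minor avoids
    the columns in [S]; it is nonzero where [a] begins with the identity
    matrix and the [b y] are 1. *)
Lemma I_0_not_sub_I_S S : (l <= d)%N -> S \in calL k l ->
  ~ (I_0 K k l d `<=` I_ K d S)%classic.
Proof.
move=> ld LS.
have /choice[g gP] : forall t : 'I_l, exists y : 'I_m, blk y = t /\ y \notin S.
  by move=> t; have [i iS] := calL_Ycol t LS; exists (Y i t); rewrite blkY.
pose f (s : 'I_l) : 'I_d := widen_ord ld s.
move=> /(_ _ (I_0_det K f g)); rewrite I_S_kernel /= phi_det rmorphM => /eqP.
have [th [thC tha thb]] := point_exists (idfun : {rmorphism K -> K})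
  (fun (x : 'I_d) (j : 'I_l) => (x == j :> nat)%:R) (fun (_ : 'I_m) => 1).
apply/negP; apply: contra_neq (oner_neq0 K) => /(congr1 th).
rewrite rmorph0 => <-; rewrite rmorphM !rmorph_prod /= big1 ?mulr1 => [|t _]; last first.
  rewrite /point_S; case: cid => /= ? [_ _ ->].
  by rewrite (negPf (gP t).2) thb.
rewrite -!det_map_mx -(det1 K l); congr (\det _); apply/matrixP => s t.
rewrite !mxE /point_S; case: cid => /= ? [_ -> _].
by rewrite tha (gP t).1.
Qed.

End Decomposition.

Theorem theorem2p6 (K : fieldType) (k l d : nat)
    (hk : (2 <= k)%N) (hkl : (k <= l)%N) (hld : (l <= d)%N) :
  radical (J_Delta K k l d) =
    (I_0 K k l d `&` \bigcap_(S in [set S | S \in calL k l]) I_ K d S)%classic /\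
  minimal_primary_decomposition (radical (J_Delta K k l d))
    (component K k l d).
Proof.
have k0 : (0 < k)%N by apply: ltnW.
have l1 : (1 < l)%N by apply: leq_trans hkl.
have l0 : (0 < l)%N by apply: ltnW.
have d0 : (0 < d)%N by apply: leq_trans hld.
have radJ := @radical_J K k l d k0 l0; split=> //.
apply: incomparable_primes_minimal.
- case=> [S|] /=; first by rewrite I_S_kernel; apply: prime_ker.
  by rewrite I_0_kernel //; apply: prime_ker.
- rewrite radJ; apply/seteqP; split=> [f [f0 fS] [S|] _ //=|f fQ].
    by apply: fS; apply: (valP S).
  split; first exact: (fQ None).
  by move=> S /= LS; apply: (fQ (Some (exist _ S LS))).
- move=> [[S LS]|] [[S' LS']|] //= ne.
  + by apply: I_S_not_sub_I_S => //; apply: contra ne => /eqP ->.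
  + exact: I_S_not_sub_I_0.
  + exact: I_0_not_sub_I_S.
Qed.
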